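(* Let $X$ be an uncountable compact metric space and let $n$ be a positive integer. Let $\mathrm{Dim}$ denote either $\dim_{\mathrm P}$ or $\overline{\dim}_{\mathrm B}$. Then $C_n(X)$ is the disjoint union of the three sets \[ A = \{ f \in C_n(X) : 0 \leq \mathrm{Dim}\, f(X) < \min\{n, \dim_{\mathrm T} X\} \}, \] \[ B = \{ f \in C_n(X) : \min\{n, \dim_{\mathrm T} X\} \leq \mathrm{Dim}\, f(X) < n \}, \] \[ C = \{ f \in C_n(X) : \mathrm{Dim}\, f(X) = n \}, \] where $A$ is nowhere dense in $C_n(X)$; $B$ is meagre but dense in $C_n(X)$, unless $n \leq \dim_{\mathrm T} X$, in which case $B$ is empty; and $C$ is residual in $C_n(X)$.
   Context: $C_n(X)$ is the Banach space of all continuous functions $f\colon X\to\mathbb{R}^n$ with the supremum norm $\|\cdot\|_\infty$. In a complete metric space, a set is meagre if it is a countable union of nowhere dense sets, and residual if its complement is meagre. $\dim_{\mathrm T}$ denotes topological (small inductive, equivalently Lebesgue covering) dimension, a non-negative integer or $+\infty$ for non-empty spaces. For a non-empty bounded $F\subseteq\mathbb{R}^n$, let $N_\delta(F)$ be the smallest number of open sets of diameter at most $\delta$ needed to cover $F$; then $\overline{\dim}_{\mathrm B} F=\limsup_{\delta\to0}\log N_\delta(F)/(-\log\delta)$. $\dim_{\mathrm P}$ denotes packing dimension, $\dim_{\mathrm P} F=\inf\{\sup_i \overline{\dim}_{\mathrm B} F_i : F\subseteq \bigcup_{i=1}^\infty F_i\}$ with the $F_i$ bounded (equivalently, the dimension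 defined by packing measures). *)

(* Defs.v *)
From HB Require Import structures.
From mathcomp Require Import all_boot all_order all_algebra.
From mathcomp Require Import all_classical all_reals all_analysis.

Set Implicit Arguments.
Unset Strict Implicit.
Unset Printing Implicit Defensive.

Import Order.TTheory GRing.Theory Num.Theory.
Import numFieldNormedType.Exports.

Local Open Scope classical_set_scope.
Local Open Scope ring_scope.

(* The norm `|v| that the library puts on 'rV[R]_n is the max norm. It induces
   the right topology and the right bounded sets on R^n, but diameters and the
   supremum norm below are taken with respect to the Euclidean norm. *)
Section EuclideanNorm.
Context {R : realType} {n : nat}.
Implicit Types (u v : 'rV[R]_n) (a : R).

Definition enorm v : R := Num.sqrt (\sum_(i < n) v ord0 i ^+ 2).

Lemma sumsq_ge0 v : 0 <= \sum_(i < n) v ord0 i ^+ 2.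
Proof. by apply: sumr_ge0 => i _; exact: sqr_ge0. Qed.

Lemma enorm_ge0 v : 0 <= enorm v.
Proof. exact: sqrtr_ge0. Qed.

Lemma enorm_sqr v : enorm v ^+ 2 = \sum_(i < n) v ord0 i ^+ 2.
Proof. exact/sqr_sqrtr/sumsq_ge0. Qed.

Lemma enorm_dot u v : \sum_(i < n) u ord0 i * v ord0 i <= enorm u * enorm v.
Proof.
set D := \sum_(i < n) _.
have key : D ^+ 2 <= (enorm u * enorm v) ^+ 2.
  rewrite exprMn !enorm_sqr -subr_ge0.
  set U := \sum_(i < n) u ord0 i ^+ 2; set V := \sum_(i < n) v ord0 i ^+ 2.
  have : 0 <= \sum_(i < n) \sum_(j < n)
      (u ord0 i * v ord0 j - u ord0 j * v ord0 i) ^+ 2.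
    by apply: sumr_ge0 => i _; apply: sumr_ge0 => j _; exact: sqr_ge0.
  suff -> : \sum_(i < n) \sum_(j < n)
      (u ord0 i * v ord0 j - u ord0 j * v ord0 i) ^+ 2 = (U * V - D ^+ 2) *+ 2.
    by rewrite pmulrn_lge0.
  have -> : (U * V - D ^+ 2) *+ 2 = U * V - (D * D) *+ 2 + V * U.
    by rewrite mulrnBl (mulrC V) mulr2n expr2 addrAC.
  rewrite /U /V /D !big_distrlr /= -sumrMnl -sumrB -big_split /=.
  apply: eq_bigr => i _; rewrite -sumrMnl -sumrB -big_split /=.
  apply: eq_bigr => j _; rewrite sqrrB !exprMn.
  by congr (_ - _ *+ 2 + _); [rewrite mulrACA (mulrC (v ord0 j)) mulrACA|
     rewrite mulrC].
have [D0|D0] := leP D 0; first by rewrite (le_trans D0)// mulr_ge0 ?enorm_ge0.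
by rewrite -(ler_pXn2r (ltn0Sn 1)) ?nnegrE ?mulr_ge0 ?enorm_ge0// ltW.
Qed.

Lemma enormD u v : enorm (u + v) <= enorm u + enorm v.
Proof.
rewrite -(ler_pXn2r (ltn0Sn 1)) ?nnegrE ?addr_ge0 ?enorm_ge0//.
rewrite sqrrD !enorm_sqr.
under eq_bigr do rewrite mxE sqrrD.
rewrite big_split [X in X + _ <= _]big_split /= lerD2r lerD2l.
by rewrite sumrMnl ler_pMn2r// enorm_dot.
Qed.

Lemma enormZ a v : enorm (a *: v) = `|a| * enorm v.
Proof.
rewrite /enorm; under eq_bigr do rewrite mxE exprMn.
by rewrite -mulr_sumr sqrtrM ?sqr_ge0// sqrtr_sqr.
Qed.

Lemma enorm_eq0 v : enorm v = 0 -> v = 0.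
Proof.
move=> v0; have := enorm_sqr v; rewrite v0 expr0n/= => /esym/eqP.
rewrite psumr_eq0 => [/allP h|i _]; last exact: sqr_ge0.
apply/rowP => i; rewrite mxE; apply/eqP; rewrite -sqrf_eq0.
by have := h i (mem_index_enum i).
Qed.

Lemma normr_le_enorm v : `|v| <= enorm v.
Proof.
rewrite [X in X <= _]mx_normrE; apply/bigmax_leP; split; first exact: enorm_ge0.
move=> [i j] _ /=; rewrite ord1 -sqrtr_sqr ler_sqrt ?sumsq_ge0//.
by rewrite (bigD1 j)//= lerDl sumr_ge0// => k _; exact: sqr_ge0.
Qed.

Lemma enorm_le_normr v : enorm v <= n%:R * `|v|.
Proof.
rewrite -(ler_pXn2r (ltn0Sn 1)) ?nnegrE ?mulr_ge0 ?enorm_ge0// enorm_sqr.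
apply: (@le_trans _ _ (\sum_(i < n) `|v| ^+ 2)).
  apply: ler_sum => i _; rewrite -real_normK ?num_real//.
  rewrite ler_pXn2r ?nnegrE//.
  have /bigmax_leP[_ /(_ (ord0, i) isT)//] :
    \big[Num.max/0]_ij `|v ij.1 ij.2| <= `|v| by rewrite -mx_normrE.
rewrite sumr_const card_ord -[leLHS]mulr_natl exprMn ler_wpM2r ?sqr_ge0//.
by rewrite -natrX ler_nat; case: (n) => // m; rewrite leq_pmulr.
Qed.

End EuclideanNorm.

Definition cont_pred (R : realType) (X : topologicalType) (n : nat) :
  {pred X -> 'rV[R]_n} := mem [set f | continuous f].

(* C_n(X), with the supremum norm. The compactness proof is a parameter of the
   type because without it the supremum need not be a norm. *)
Record Cn (R : realType) (X : topologicalType) (cX : compact [set: X])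
    (n : nat) := MkCn {
  Cn_fun :> X -> 'rV[R]_n ;
  _ : Cn_fun \in @cont_pred R X n }.

Arguments Cn R {X} cX n.

Section CnBanach.
Context {R : realType} {X : topologicalType} (cX : compact [set: X]) (n : nat).
Local Notation Cn := (Cn R cX n).
Local Notation cont_pred := (@cont_pred R X n).
Local Notation Cn_fun := (@Cn_fun R X cX n).

HB.instance Definition _ := [isSub of Cn for Cn_fun].
HB.instance Definition _ := [Choice of Cn by <:].

Lemma Cn_continuous (f : Cn) : continuous f.
Proof. by have := valP f; rewrite inE. Qed.

Lemma cont_submod_closed : submod_closed cont_pred.
Proof.
split; first by rewrite inE => x; exact: cvg_cst.
move=> a f g; rewrite !inE => cf cg x.
by apply: cvgD; [apply: cvgZr; exact: cf|exact: cg].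
Qed.

HB.instance Definition _ :=
  GRing.isSubmodClosed.Build R (X -> 'rV[R]_n) cont_pred cont_submod_closed.
HB.instance Definition _ := [SubChoice_isSubLmodule of Cn by <:].

Definition sup_norm (f : Cn) : R := sup (range (fun x => enorm (f x))).

Lemma has_ubound_enorm (f : Cn) : has_ubound (range (fun x => enorm (f x))).
Proof.
have : compact (range f).
  by apply: continuous_compact => //; apply/continuous_subspaceT/Cn_continuous.
move=> /compact_bounded[M [_ fM]]; exists (n%:R * (M + 1)) => _ [x _ <-].
rewrite (le_trans (enorm_le_normr _))// ler_wpM2l//.
by apply: fM; [rewrite ltrDl|exists x].
Qed.

Lemma enorm_le_sup_norm (f : Cn) x : enorm (f x) <= sup_norm f.
Proof. by apply: ub_le_sup; [exact: has_ubound_enorm|exists x]. Qed.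

Lemma sup_norm_le (f : Cn) (M : R) :
  0 <= M -> (forall x, enorm (f x) <= M) -> sup_norm f <= M.
Proof.
move=> M0 fM; rewrite /sup_norm.
have [->|/set0P ne] := eqVneq (range (fun x => enorm (f x))) set0.
  by rewrite ?sup0.
by apply: ge_sup => // _ [x _ <-].
Qed.

Lemma sup_norm_ge0 (f : Cn) : 0 <= sup_norm f.
Proof.
rewrite /sup_norm.
have [->|/set0P[_ [x _ _]]] := eqVneq (range (fun x => enorm (f x))) set0.
  by rewrite ?sup0.
exact: le_trans (enorm_ge0 _) (enorm_le_sup_norm f x).
Qed.

Lemma sup_normD (f g : Cn) : sup_norm (f + g) <= sup_norm f + sup_norm g.
Proof.
apply: sup_norm_le => [|x]; first by rewrite addr_ge0 ?sup_norm_ge0.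
by rewrite (le_trans (enormD _ _))// lerD ?enorm_le_sup_norm.
Qed.

Lemma sup_normZ (a : R) (f : Cn) : sup_norm (a *: f) = `|a| * sup_norm f.
Proof.
have le_Z b g : sup_norm (b *: g) <= `|b| * sup_norm g.
  apply: sup_norm_le => [|x]; first by rewrite mulr_ge0 ?sup_norm_ge0.
  by rewrite enormZ ler_wpM2l// enorm_le_sup_norm.
apply/eqP; rewrite eq_le le_Z/=.
have [->|a0] := eqVneq a 0; first by rewrite normr0 mul0r sup_norm_ge0.
rewrite -ler_pdivlMl ?normr_gt0// -normfV.
by rewrite (le_trans _ (le_Z _ _))// scalerA mulVf// scale1r.
Qed.

Lemma sup_norm_eq0 (f : Cn) : sup_norm f = 0 -> f = 0.
Proof.
move=> f0; apply/val_inj/funext => x; apply: enorm_eq0; apply/eqP.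
by rewrite eq_le enorm_ge0 andbT -f0 enorm_le_sup_norm.
Qed.

HB.instance Definition _ :=
  Lmodule_isNormed.Build R Cn sup_normD sup_normZ sup_norm_eq0.

Lemma Cn_complete (F : set_system Cn) : ProperFilter F -> cauchy F -> cvg F.
Proof.
move=> FF Fc.
pose T := arrow_uniform_type X 'rV[R]_n.
pose G : set_system T := (Cn_fun : Cn -> T) @ F.
have dist_le (f g : Cn) x : enorm (f x - g x) <= `|f - g|.
  exact: (enorm_le_sup_norm (f - g)).
have Gc : cauchy G.
  apply/cauchyP => e e0; have /cauchyP/(_ e e0)[f Ff] := Fc.
  exists (Cn_fun f).
  have sub : ball f e `<=` [set g : Cn | ball (f : T) e (g : T)].
    move=> g; rewrite -ball_normE/= => fg x.
    suff : ball_ Num.norm (f x) e (g x) by rewrite ball_normE.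
    rewrite /ball_/= (le_lt_trans (normr_le_enorm _))//.
    exact: le_lt_trans (dist_le f g x) fg.
  exact: filterS sub Ff.
have /cvg_ex[g Gg] : cvg G by exact: cauchy_cvg.
have cg : continuous (g : X -> 'rV[R]_n).
  apply: (@uniform_limit_continuous _ _ G).
  - by apply: (@filterE _ F _ (fun f : Cn => continuous (f : X -> _))) => f;
      exact: Cn_continuous.
  - by rewrite /= uniform_nbhsT.
have gP : (g : X -> 'rV[R]_n) \in cont_pred by rewrite inE.
apply/cvg_ex; exists (MkCn cX gP); apply/cvgrPdist_le => e e0.
have d0 : 0 < e / n.+1%:R by rewrite divr_gt0.
have : \forall f \near F, ball g (e / n.+1%:R) ((f : Cn) : T).
  by have /fcvg_ballP/(_ _ d0) := Gg.
apply: filterS => f gf; apply: sup_norm_le; first exact: ltW.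
move=> x; rewrite (le_trans (enorm_le_normr _))//.
have : ball_ Num.norm (g x) (e / n.+1%:R) (f x) by rewrite ball_normE; exact: gf.
rewrite /ball_/= => /ltW h.
rewrite (le_trans (ler_wpM2l (ler0n _ n) h))// mulrCA ler_piMr ?(ltW e0)//.
by rewrite ler_pdivrMr ?ltr0n// mul1r ler_nat.
Unshelve. all: by end_near. Qed.

HB.instance Definition _ := Uniform_isComplete.Build Cn Cn_complete.

End CnBanach.

Section Category.
Context {T : topologicalType}.
Implicit Types A : set T.

Definition nowhere_dense A := interior (closure A) = set0.

Definition meagre A := exists2 F : (set T)^nat,
  (forall i, nowhere_dense (F i)) & A = \bigcup_i F i.

Definition residual A := meagre (~` A).

End Category.

(* Lebesgue covering dimension: a cover V has order at most d when no point
   lies in more than d + 1 of its members. *)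
Definition covering_dim_le (X : topologicalType) (d : nat) : Prop :=
  forall (k : nat) (U : 'I_k -> set X),
    (forall i, open (U i)) -> \bigcup_i U i = [set: X] ->
  exists (l : nat) (V : 'I_l -> set X),
    [/\ forall j, open (V j),
        \bigcup_j V j = [set: X],
        forall j, exists i, V j `<=` U i
      & forall J : {set 'I_l}, (d.+1 < #|J|)%N ->
          \bigcap_(j in [set` J]) V j = set0].

(* The value is +oo when no d works; for the empty space it is 0, not -1. *)
Definition dimT (R : realType) (X : topologicalType) : \bar R :=
  ereal_inf [set d%:R%:E | d in covering_dim_le X].

Section FractalDimensions.
Context {R : realType} {n : nat}.
Implicit Types (F U : set 'rV[R]_n) (delta : R).

Local Open Scope ereal_scope.

(* An extended real, so that unbounded sets have diameter +oo. *)
Definition diam U : \bar R :=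
  ereal_sup [set (enorm (z.1 - z.2))%:E | z in U `*` U].

Definition covered_by delta F (k : nat) : Prop :=
  exists U : 'I_k -> set 'rV[R]_n,
    (forall i, open (U i) /\ diam (U i) <= delta%:E) /\ F `<=` \bigcup_i U i.

(* For bounded F the infimum is a minimum; it is +oo if no finite cover exists. *)
Definition covering_number delta F : \bar R :=
  ereal_inf [set k%:R%:E | k in covered_by delta F].

Definition upper_box_dim F : \bar R :=
  limf_esup (fun delta => lne (covering_number delta F) / (- ln delta)%:E) 0^'+.

(* Empty pieces G i are harmless: their upper_box_dim is -oo. *)
Definition packing_dim F : \bar R :=
  ereal_inf [set ereal_sup (range (fun i => upper_box_dim (G i))) |
    G in [set G : (set 'rV[R]_n)^nat |
      (forall i, bounded_set (G i)) /\ F `<=` \bigcup_i G i]].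

End FractalDimensions.

(* Main.v *)
Require Import Defs.
From HB Require Import structures.
From mathcomp Require Import all_boot all_order all_algebra.
From mathcomp Require Import all_classical all_reals all_analysis.
From mathcomp Require Import ring lra.

(* The packing dimension is the smaller one, and for the image of a compact space
   both dimensions lie between 0 and n, so it suffices to show that packing
   dimension less than n is meagre, packing dimension less than min(n, dim_T X)
   nowhere dense, and, when dim_T X < n, box dimension less than n dense.

   Meagre: X contains a nonempty closed set P every nonempty relatively open
   part of which is infinite. Prescribing the values of f at finitely many points of
   such a part shows that, generically, f spreads it over M^n points at mutual
   distance about c / M, for arbitrarily large M. If sets G_i cover f(X), then by
   Baire's theorem in P, f maps such a part into the closure of some G_i, and
   this G_i has upper box dimension at least n.

   Dense: composing f with the canonical map to the nerve of a fine cover of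
   order at most d + 1 gives a function close to f with values in a finite union
   of simplices of dimension at most d.

   Nowhere dense: if functions with packing dimension less than m are dense in a
   ball, then, locally on X, every continuous map to R^m can be perturbed to
   avoid the origin, since by Baire's theorem the projection of a set of packing
   dimension less than m to R^m has empty interior. By Hemmingsen's criterion
   dim_T X < m. *)

Set Implicit Arguments.
Unset Strict Implicit.
Unset Printing Implicit Defensive.

Import Order.TTheory GRing.Theory Num.Theory.
Import numFieldNormedType.Exports.

Local Open Scope classical_set_scope.
Local Open Scope ring_scope.
Local Open Scope ereal_scope.

(** * Estimates between the Euclidean norm, the max norm and the coordinates *)

Section EuclideanNormTheory.
Context {R : realType} {n : nat}.
Implicit Types (u v w : 'rV[R]_n) (A : set 'rV[R]_n).
Local Open Scope ring_scope.

Lemma enorm0 : enorm (0 : 'rV[R]_n) = 0.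
Proof. by rewrite -(scale0r (0 : 'rV[R]_n)) enormZ normr0 mul0r. Qed.

Lemma enormN u : enorm (- u) = enorm u.
Proof. by rewrite -scaleN1r enormZ normrN1 mul1r. Qed.

Lemma enormB u v : enorm (u - v) = enorm (v - u).
Proof. by rewrite -enormN opprB. Qed.

Lemma enorm_triangle v u w : enorm (u - w) <= enorm (u - v) + enorm (v - w).
Proof. by rewrite (le_trans _ (enormD _ _))// addrA subrK. Qed.

Lemma normr_coord_le u i : `|u ord0 i| <= `|u|.
Proof.
rewrite [leRHS]mx_normrE.
have /bigmax_leP[_ /(_ (ord0, i) isT)//] :
  \big[Num.max/0]_ij `|u ij.1 ij.2| <= \big[Num.max/0]_ij `|u ij.1 ij.2| by [].
Qed.

Lemma normr_rV_le u (e : R) :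
  0 <= e -> (forall i, `|u ord0 i| <= e) -> `|u| <= e.
Proof.
move=> e0 ue; rewrite [leLHS]mx_normrE; apply/bigmax_leP; split => // -[i j] _.
by rewrite ord1.
Qed.

Lemma normr_coord_le_enorm u i : `|u ord0 i| <= enorm u.
Proof. exact: le_trans (normr_coord_le u i) (normr_le_enorm u). Qed.

Lemma nbhs_enorm u (e : R) : 0 < e -> nbhs u [set v | enorm (u - v) < e].
Proof.
move=> e0; apply/nbhs_ballP; exists (e / n.+1%:R); first by rewrite /= divr_gt0.
move=> v; rewrite -ball_normE/= => uv; rewrite (le_lt_trans (enorm_le_normr _))//.
have -> : e = n.+1%:R * (e / n.+1%:R) by rewrite mulrC divfK.
apply: (@le_lt_trans _ _ (n.+1%:R * `|u - v|)); first by rewrite ler_wpM2r// ler_nat.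
by rewrite ltr_pM2l.
Qed.

Lemma open_enorm_ball u (e : R) : open [set v | enorm (u - v) < e].
Proof.
rewrite openE => v /= uv; rewrite /interior.
have : nbhs v [set w | enorm (v - w) < e - enorm (u - v)].
  by apply: nbhs_enorm; rewrite subr_gt0.
apply: filterS => w /= vw; rewrite (le_lt_trans (enorm_triangle v _ _))//.
by rewrite -ltrBrDl.
Qed.

Lemma closure_enorm A u (e : R) : closure A u -> 0 < e ->
  exists2 v, A v & enorm (u - v) < e.
Proof.
by move=> Au e0; have [v [Av uv]] := Au _ (nbhs_enorm u e0); exists v.
Qed.

End EuclideanNormTheory.

(** * Upper and lower bounds for box and packing dimension *)

Section BoxDimension.
Context {R : realType}.

(* Distance at least 3 d, rather than merely more than d, so that the property
   survives moving every point by d / 2. *)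
Definition separated n (F : set 'rV[R]_n) (d : R) (L : nat) :=
  exists p : 'I_L -> 'rV[R]_n, (forall i, F (p i)) /\
    forall i j, i != j -> (3 * d <= enorm (p i - p j))%R.

(** Points of the family are within [d / 2] of images of points of [G]. If two of the latter shared
    a covering set, the members of the family would be less than [2 d] apart, so [G] needs at least
    [L] sets. The closure and the nonexpansive [h] serve the later uses of Baire's theorem. *)
Lemma covering_number_ge n m (h : 'rV[R]_n -> 'rV[R]_m) G d L :
  (forall u v, (enorm (h u - h v) <= enorm (u - v))%R) -> (0 < d)%R ->
  separated (closure (h @` G)) d L -> L%:R%:E <= covering_number d G.
Proof.
move=> h1 d0 [p [pG psep]]; apply: le_ereal_inf_tmp => _ [k [U [Ud GU]] <-].
rewrite lee_fin ler_nat.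
have d20 : (0 < d / 2)%R by rewrite divr_gt0.
have /choice[q qP] (i : 'I_L) :
    exists v, G v /\ (enorm (p i - h v) < d / 2)%R.
  by have [_ [v Gv <-] ?] := closure_enorm (pG i) d20; exists v.
have /choice[c cP] (i : 'I_L) : exists j, U j (q i).
  by have [j _ ?] := GU _ (qP i).1; exists j.
suff /leq_card : injective c by rewrite !card_ord.
move=> i j cij; apply/eqP/negPn/negP => /psep.
apply/negP; rewrite -ltNge.
have : (enorm (q i - q j) <= d)%R.
  have [_] := Ud (c i); rewrite -lee_fin; apply: le_trans.
  apply: ereal_sup_ubound; exists (q i, q j) => //; split; first exact: cP.
  by rewrite /= cij; exact: cP.
move=> /(le_trans (h1 _ _)) qij.
have := enorm_triangle (h (q i)) (p i) (p j).
have := enorm_triangle (h (q j)) (h (q i)) (p j).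
have := (qP i).2; have := (qP j).2; rewrite (enormB (h (q j)) (p j)).
lra.
Qed.

(** An upper limit is bounded below by the values at arbitrarily small scales [d]. *)
Lemma upper_box_dim_ge n (F : set 'rV[R]_n) (s : R) :
  (forall e, (0 < e)%R -> exists d L, [/\ (0 < d < e)%R, (0 < L)%N,
     ((s - e) * - ln d <= ln L%:R)%R & L%:R%:E <= covering_number d F]) ->
  s%:E <= upper_box_dim F.
Proof.
move=> sF; apply/lee_addgt0Pr => e e0; rewrite -leeBlDr//.
apply: le_ereal_inf_tmp => _ [V V0 <-].
have /nbhs_ballP[r /= r0 rV] : nbhs (0%R : R) [set x | (0 < x)%R -> V x] by [].
(* [d < 1] makes [- ln d] positive, and [d < r] puts [d] in the neighbourhood [V]. *)
pose e' := Num.min (Num.min e 1%R) r.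
have e'0 : (0 < e')%R by rewrite !lt_min e0 ltr01 r0.
have [d [L [/andP[d0]]]] := sF _ e'0; rewrite !lt_min -!andbA => /and3P[de d1 dr].
move=> L0 sL LN; have lnd : (ln d < 0)%R by rewrite ln_lt0// d0.
apply: le_ereal_sup_tmp.
exists (lne (covering_number d F) / (- ln d)%:E); last first.
  rewrite inver oppr_eq0 lt_eqF// lee_pdivlMr ?oppr_gt0// -EFinB -EFinM.
  apply: (@le_trans _ _ (ln L%:R)%:E).
    rewrite lee_fin (le_trans _ sL)// ler_wpM2r ?oppr_ge0 ?(ltW lnd)// lerB//.
    by rewrite /e' !ge_min lexx.
  rewrite -lne_EFin ?ltr0n// lee_lne// !in_itv/= leey andbT ?lee_fin//.
  by rewrite (le_trans _ LN).
exists d => //; apply: rV => //=; rewrite -ball_normE/= sub0r normrN gtr0_norm//.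
Qed.

Lemma separated_fintype (T : finType) n (F : set 'rV[R]_n) (d : R)
    (p : T -> 'rV[R]_n) : (forall a, F (p a)) ->
  (forall a b, a != b -> (3 * d <= enorm (p a - p b))%R) -> separated F d #|T|.
Proof.
move=> pF psep; exists (fun i => p (enum_val i)); split => // i j ij.
by apply: psep; rewrite (inj_eq enum_val_inj).
Qed.

Lemma grid_coord_le (m M : nat) (a : {ffun 'I_m -> 'I_M}) j :
  (0 <= ((a j)%:R / M%:R : R) <= 1)%R.
Proof.
have M0 : (0 < M)%N by rewrite (leq_ltn_trans _ (ltn_ord (a j))).
by rewrite divr_ge0//= ler_pdivrMr ?ltr0n// mul1r ler_nat ltnW.
Qed.

Lemma grid_separated (m M : nat) (a b : {ffun 'I_m -> 'I_M}) : a != b ->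
  exists j, (M%:R^-1 <= `|(a j)%:R / M%:R - (b j)%:R / M%:R :> R|)%R.
Proof.
move=> ab; have [j jab] : exists j, a j != b j.
  apply/existsP; apply: contraNT ab; rewrite negb_exists => /forallP ab.
  by apply/eqP/ffunP => j; apply/eqP; have := ab j; rewrite negbK.
exists j; rewrite -mulrBl normrM normfV normr_nat ler_peMl ?invr_ge0//.
have [ij|ij|/val_inj ij] := ltngtP (a j) (b j).
- by rewrite distrC ger0_norm ?subr_ge0 ?ler_nat ?(ltnW ij)// -natrB ?(ltnW ij)//
     ler1n subn_gt0.
- by rewrite ger0_norm ?subr_ge0 ?ler_nat ?(ltnW ij)// -natrB ?(ltnW ij)//
     ler1n subn_gt0.
- by move: jab; rewrite ij eqxx.
Qed.

(** The constant [c] costs [- (m - e) ln c], which the slack [e ln M] absorbs once [M] is large. *)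
Lemma grid_rate (m : nat) (c e : R) : (0 < c)%R -> (0 < e)%R ->
  exists M, [/\ (0 < M)%N, (c / M%:R < e)%R &
    ((m%:R - e) * - ln (c / M%:R) <= ln (M ^ m)%N%:R)%R].
Proof.
move=> c0 e0; set B := expR (`|(m%:R - e) * ln c| / e)%R.
exists (Num.truncn (c / e) + Num.truncn B).+1.
set M := (_ + _).+1; have M0 : (0 < M%:R :> R)%R by rewrite ltr0n.
have cM : (c / e < M%:R)%R.
  by rewrite (lt_le_trans (truncnS_gt _))// ler_nat ltnS leq_addr.
have BM : (B <= M%:R)%R.
  by rewrite ltW// (lt_le_trans (truncnS_gt _))// ler_nat ltnS leq_addl.
split => //.
  by rewrite ltr_pdivrMr// mulrC -ltr_pdivrMr.
rewrite lnM ?posrE ?invr_gt0// lnV ?posrE// natrX lnXn// -mulr_natl.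
have : (`|(m%:R - e) * ln c| / e <= ln M%:R)%R.
  by rewrite -[X in (X <= _)%R]expRK ler_ln ?posrE ?expR_gt0.
rewrite ler_pdivrMr//.
have := ler_norm (- ((m%:R - e) * ln c))%R; rewrite normrN.
lra.
Qed.

(** The points form a grid of spacing [r / M] in the cube with corner [c] and side [r]; the factor 3
    in [separated] accounts for [r / 3]. *)
Lemma separated_ball m (c : 'rV[R]_m) (r : R) (M : nat) :
  (0 < r)%R -> (0 < M)%N ->
  separated [set v | (`|v - c| <= r)%R] (r / 3 / M%:R) (M ^ m)%N.
Proof.
move=> r0 M0; have -> : (M ^ m)%N = #|{ffun 'I_m -> 'I_M}|.
  by rewrite card_ffun !card_ord.
pose p (a : {ffun 'I_m -> 'I_M}) : 'rV[R]_m :=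
  (c + \row_j (r * ((a j)%:R / M%:R)))%R.
apply: (separated_fintype (p := p)) => [a|a b ab].
  rewrite /= /p addrC addKr; apply: normr_rV_le => [|j]; first exact: ltW.
  have /andP[a0 a1] := grid_coord_le a j.
  by rewrite mxE normrM (gtr0_norm r0) ger0_norm// ler_piMr// ltW.
have [j ij] := grid_separated ab.
apply: le_trans (normr_coord_le_enorm _ j).
rewrite !mxE opprD addrACA subrr add0r -mulrBr normrM (gtr0_norm r0).
have -> : (3 * (r / 3 / M%:R) = r * M%:R^-1)%R by field; rewrite pnatr_eq0 -lt0n.
by rewrite ler_wpM2l// ltW.
Qed.

Lemma upper_box_dim_ge_separated n m (h : 'rV[R]_n -> 'rV[R]_m) G (c : R) :
  (forall u v, (enorm (h u - h v) <= enorm (u - v))%R) -> (0 < c)%R ->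
  (forall M, (0 < M)%N -> separated (closure (h @` G)) (c / M%:R) (M ^ m)%N) ->
  m%:R%:E <= upper_box_dim G.
Proof.
move=> h1 c0 sG; apply: upper_box_dim_ge => e e0.
have [M [M0 Me ML]] := grid_rate m c0 e0.
have cM0 : (0 < c / M%:R)%R by rewrite divr_gt0// ltr0n.
exists (c / M%:R)%R, (M ^ m)%N; split => //; first by rewrite cM0.
  by rewrite expn_gt0 M0.
exact: covering_number_ge h1 cM0 (sG _ M0).
Qed.

(** A ball inside the closure would contain grids of [M ^ m] points at a scale proportional to
    [1 / M] for all [M], forcing upper box dimension at least [m] on [G]. *)
Lemma interior_closure_eq0 n m (h : 'rV[R]_n -> 'rV[R]_m) G :
  (forall u v, (enorm (h u - h v) <= enorm (u - v))%R) ->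
  upper_box_dim G < m%:R%:E -> (closure (h @` G))^° = set0.
Proof.
move=> h1; apply: contraPP => /eqP/set0P[c /nbhs_ballP[r /= r0 rG]].
apply/negP; rewrite -leNgt.
have r2 : (0 < r / 2)%R by rewrite divr_gt0.
apply: (@upper_box_dim_ge_separated _ _ h _ (r / 2 / 3)) => // [|M M0].
  by rewrite divr_gt0.
have [p [pr psep]] := separated_ball c r2 M0.
exists p; split => // i; apply: rG.
rewrite -ball_normE/= distrC (le_lt_trans (pr i))// ltr_pdivrMr// ltr_pMr//.
by rewrite ltr1n.
Qed.

(** [K * expR (s * - ln d)] is [K d^(-s)]; the factor [K] adds [ln K / (- ln d)] to the exponent, at
    most [e] for [d < r]. *)
Lemma upper_box_dim_le n (F : set 'rV[R]_n) (s K : R) : (1 <= K)%R ->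
  (forall d : R, (0 < d < 1)%R ->
    exists2 k : nat, Defs.covered_by d F k & (k%:R <= K * expR (s * - ln d))%R) ->
  upper_box_dim F <= s%:E.
Proof.
move=> K1 FK; apply/lee_addgt0Pr => e e0.
pose r := Num.min 1%R (expR (- (ln K / e))).
have r0 : (0 < r)%R by rewrite lt_min ltr01 expR_gt0.
have K0 : (0 < K)%R := lt_le_trans ltr01 K1.
apply: ge_ereal_inf; exists (ereal_sup
  [set lne (covering_number d F) / (- ln d)%:E | d in [set d : R | (0 < d < r)%R]]).
  exists [set d : R | (0 < d < r)%R] => //.
  near=> d; apply/andP; split; first by near: d; exact: nbhs_right_gt.
  by near: d; exact: nbhs_right_lt.
apply: ge_ereal_sup => _ [d /= /andP[d0 dr] <-].
have d1 : (d < 1)%R by rewrite (lt_le_trans dr)// ge_min lexx.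
have lnd : (ln d < 0)%R by rewrite ln_lt0// d0.
rewrite inver oppr_eq0 lt_eqF// lee_pdivrMr ?oppr_gt0//.
have [k kF kK] := FK d (introT andP (conj d0 d1)).
apply: (@le_trans _ _ (lne (K * expR (s * - ln d))%:E)).
  rewrite lee_lne// ?in_itv/= ?leey ?andbT.
  - by rewrite (@le_trans _ _ k%:R%:E)// ?lee_fin//; apply: ereal_inf_lbound; exists k.
  - by apply: le_ereal_inf_tmp => _ [l _ <-]; rewrite lee_fin.
  - by rewrite lee_fin mulr_ge0 ?expR_ge0// ltW.
rewrite lne_EFin ?mulr_gt0 ?expR_gt0// lnM ?posrE ?expR_gt0// expRK.
rewrite -EFinD -EFinM lee_fin mulrDl addrC lerD2l.
have : (ln d < - (ln K / e))%R.
  rewrite -[ltRHS]expRK ltr_ln ?posrE ?expR_gt0// (lt_le_trans dr)// ge_min lexx.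
  by rewrite orbT.
by rewrite ltrNr => /ltW; rewrite ler_pdivrMr// mulrC.
Unshelve. all: by end_near. Qed.

(** Each unit cube is cut into [M ^ m] cells with [M] of order [1 / d]; by the Lipschitz bound,
    Euclidean balls of radius [d / 2] around the images of the grid points cover [F]. *)
Lemma upper_box_dim_le_cubes (T : finType) m n
    (phi : T -> 'rV[R]_m -> 'rV[R]_n) (C : R) (F : set 'rV[R]_n) :
  (forall a t u, (enorm (phi a t - phi a u) <= C * `|t - u|)%R) ->
  F `<=` \bigcup_a [set phi a t |
    t in [set t : 'rV[R]_m | forall i, (0 <= t ord0 i <= 1)%R]] ->
  upper_box_dim F <= m%:R%:E.
Proof.
move=> phiC Fphi; pose D : R := (`|C| + 1)%R.
have D0 : (0 < D)%R by rewrite ltr_wpDl.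
pose K : R := (#|T|.+1%:R * (2 * D + 1) ^+ m)%R.
have K1 : (1 <= K)%R.
  by rewrite mulr_ege1 ?ler1n// exprn_ege1// lerDr mulr_ge0// ltW.
apply: (upper_box_dim_le K1) => d /andP[d0 d1].
(* More than [2 D / d] cells per side make the images of cells small enough, and [d < 1] keeps [M]
   at most [(2 D + 1) / d]. *)
pose M := (Num.truncn (2 * D / d)).+1.
have M0 : (0 < M%:R :> R)%R by rewrite ltr0n.
have dM : (2 * D / d < M%:R)%R by rewrite truncnS_gt.
have Md : (M%:R <= (2 * D + 1) / d)%R.
  have -> : (M%:R = (Num.truncn (2 * D / d))%:R + 1 :> R)%R by rewrite natr1.
  rewrite (mulrDl (2 * D)%R) lerD//.
    by rewrite truncn_le// divr_ge0// ?mulr_ge0// ltW.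
  by rewrite mul1r invf_ge1// ltW.
pose I := (T * {ffun 'I_m -> 'I_M})%type.
pose pt (a : I) := phi a.1 (\row_i ((a.2 i)%:R / M%:R))%R.
exists #|{: I}|; last first.
  rewrite card_prod card_ffun !card_ord natrM natrX /K -mulrA.
  rewrite expRM_natl expRN lnK ?posrE// -exprMn.
  by rewrite ler_pM ?ler_nat ?exprn_ge0// lerXn2r ?nnegrE ?(ltW M0)// (le_trans _ Md).
exists (fun i => [set y | (enorm (pt (enum_val i) - y) < d / 2)%R]).
split => [i|y /Fphi[a _ [t t01 <-]]].
  split; first exact: open_enorm_ball.
  apply: ge_ereal_sup => _ [[u v] /= [pu pv] <-]; rewrite lee_fin.
  rewrite (le_trans (enorm_triangle (pt (enum_val i)) _ _))// enormB.
  by rewrite (splitr d) lerD// ltW.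
(* A coordinate equal to 1 would get the index [M]; it is put in the last cell. *)
have lt_idx i : (minn (Num.truncn (t ord0 i * M%:R)) M.-1 < M)%N.
  by rewrite ltnS geq_minr.
pose g : {ffun 'I_m -> 'I_M} := [ffun i => Ordinal (lt_idx i)].
exists (enum_rank ((a, g) : I)) => //=; rewrite enum_rankK /pt/=.
rewrite (le_lt_trans (phiC _ _ _))//.
have : (`|(\row_i ((g i)%:R / M%:R)) - t| <= M%:R^-1)%R.
  apply: normr_rV_le => [|i]; first by rewrite invr_ge0.
  rewrite !mxE ffunE/=.
  have /andP[t0 t1] := t01 i.
  have tM0 : (0 <= t ord0 i * M%:R)%R by rewrite mulr_ge0.
  have tM1 : (t ord0 i * M%:R <= M%:R)%R by rewrite ler_piMl// ltW.
  have /andP[l u] := truncn_itv tM0.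
  set k := minn _ _.
  have -> : (k%:R / M%:R - t ord0 i = (k%:R - t ord0 i * M%:R) / M%:R)%R.
    by rewrite mulrBl mulfK ?gt_eqF.
  rewrite normrM normfV normr_nat ler_piMl ?invr_ge0// /k /minn; case: ltnP => h.
    by rewrite ler_norml; move: l u; rewrite -natr1; lra.
  have Mt : (M.-1%:R <= t ord0 i * M%:R)%R by rewrite (le_trans _ l)// ler_nat.
  have M1 : (M%:R = M.-1%:R + 1 :> R)%R by rewrite natr1.
  by rewrite ler_norml; move: tM1 Mt; rewrite M1; lra.
have CD : (C <= D)%R by rewrite /D (le_trans (ler_norm C))// lerDl.
move=> gt.
rewrite (le_lt_trans (ler_wpM2r (normr_ge0 _) CD))//.
rewrite (le_lt_trans (ler_wpM2l (ltW D0) gt))//.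
move: dM; rewrite ltr_pdivrMr// => dM.
by rewrite ltr_pdivrMr//; lra.
Qed.

(** This is the separation bound in dimension 0, with [h] constant: [M ^ 0] is a single point. *)
Lemma upper_box_dim_ge0 n (F : set 'rV[R]_n) : F !=set0 -> 0 <= upper_box_dim F.
Proof.
move=> [x Fx]; have := @upper_box_dim_ge_separated n 0 (fun=> 0%R) F 1.
apply => // [u v|M _]; first by rewrite subrr enorm0 enorm_ge0.
exists (fun=> 0%R); split => [_|[i i0] [j j0]].
  by apply: subset_closure; exists x.
by rewrite expn0 in i0 j0 *; rewrite -val_eqE/=; case: i i0 => //; case: j j0.
Qed.

(** A bounded set lies in one affine image of the unit cube. *)
Lemma upper_box_dim_le_dim n (F : set 'rV[R]_n) :
  bounded_set F -> upper_box_dim F <= n%:R%:E.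
Proof.
move=> [M0 [_ FM]]; pose M : R := (`|M0| + 1)%R.
have {}FM x : F x -> (`|x| <= M)%R.
  by apply: FM; rewrite /M (le_lt_trans (ler_norm M0))// ltrDl.
have M0' : (0 < M)%R by rewrite /M ltr_wpDl.
pose phi (_ : unit) (t : 'rV[R]_n) : 'rV[R]_n := ((2 * M) *: t - const_mx M)%R.
apply: (@upper_box_dim_le_cubes _ n n phi (n%:R * (2 * M))%R) => [a t u|x /FM xM].
  rewrite /phi opprB addrA subrK -scalerBr enormZ mulrAC mulrC.
  rewrite ger0_norm ?mulr_ge0 ?(ltW M0')//.
  by rewrite ler_wpM2r ?mulr_ge0 ?(ltW M0')// enorm_le_normr.
exists tt => //; exists ((2 * M)^-1 *: (x + const_mx M))%R => /=.
  move=> i; rewrite !mxE.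
  have := le_trans (normr_coord_le x i) xM; rewrite ler_norml => /andP[l u].
  rewrite mulr_ge0 ?invr_ge0 ?mulr_ge0 ?(ltW M0')//=; last by rewrite -lerBlDr sub0r.
  by rewrite mulrC ler_pdivrMr ?mulr_gt0// mul1r; lra.
by rewrite /phi scalerA divff ?scale1r ?addrK// gt_eqF// mulr_gt0.
Qed.

Lemma packing_dim_le_upper_box_dim n (F : set 'rV[R]_n) :
  bounded_set F -> packing_dim F <= upper_box_dim F.
Proof.
move=> bF; apply: ge_ereal_inf; exists (upper_box_dim F) => //.
exists (fun=> F); first by split => // x Fx; exists 0%N.
apply/eqP; rewrite eq_le; apply/andP; split.
  by apply: ge_ereal_sup => _ [_ _ <-].
by apply: ereal_sup_ubound; exists 0%N.
Qed.

Lemma packing_dim_ge n (F : set 'rV[R]_n) (s : \bar R) :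
  (forall G : (set 'rV[R]_n)^nat, F `<=` \bigcup_i G i ->
    exists i, s <= upper_box_dim (G i)) -> s <= packing_dim F.
Proof.
move=> sF; apply: le_ereal_inf_tmp => _ [G [_ /sF[i si]] <-].
by rewrite (le_trans si)//; apply: ereal_sup_ubound; exists i.
Qed.

Lemma packing_dim_lt n (F : set 'rV[R]_n) (s : \bar R) : packing_dim F < s ->
  exists2 G : (set 'rV[R]_n)^nat, F `<=` \bigcup_i G i &
    forall i, upper_box_dim (G i) < s.
Proof.
move=> /ereal_inf_lt[_ [G [_ FG] <-] Gs]; exists G => // i.
by rewrite (le_lt_trans _ Gs)//; apply: ereal_sup_ubound; exists i.
Qed.

Lemma packing_dim_ge0 n (F : set 'rV[R]_n) : F !=set0 -> 0 <= packing_dim F.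
Proof.
move=> [x Fx]; apply: packing_dim_ge => G FG; have [i _ Gx] := FG _ Fx.
by exists i; apply: upper_box_dim_ge0; exists x.
Qed.

End BoxDimension.

(** * Nowhere dense and meagre sets *)

Section Category.
Context {T : topologicalType}.
Implicit Types A B O : set T.

Lemma nowhere_denseS A B : A `<=` B -> nowhere_dense B -> nowhere_dense A.
Proof.
rewrite /nowhere_dense => AB B0; rewrite -subset0 -B0.
by apply: interiorS; exact: closureS.
Qed.

Lemma nowhere_dense_setC O : open O -> dense O -> nowhere_dense (~` O).
Proof.
move=> oO dO; rewrite /nowhere_dense.
have -> : closure (~` O) = ~` O by apply/esym/closure_id; rewrite closedC.
apply/eqP/negPn/negP => /set0P OC; have [x [Ox Cx]] := dO _ OC (@open_interior _ _).
exact: (interior_subset Ox).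
Qed.

Lemma meagreS A B : A `<=` B -> meagre B -> meagre A.
Proof.
move=> AB [F Fnd BF]; exists (fun i => F i `&` A) => [i|].
  by apply: nowhere_denseS (Fnd i) => x [].
by rewrite -setI_bigcupl -BF setIC; apply/esym/setIidPl.
Qed.

Lemma meagre_setC_bigcap (O : (set T)^nat) :
  (forall i, open (O i) /\ dense (O i)) -> meagre (~` (\bigcap_i O i)).
Proof.
move=> Ood; exists (fun i => ~` O i) => [i|]; last by rewrite setC_bigcap.
by have [oO dO] := Ood i; exact: nowhere_dense_setC.
Qed.

End Category.

(** * Baire's theorem on a compact set *)

Section CompactBaire.
Context {R : realType} {X : pseudoMetricType R}.
Local Open Scope ring_scope.

(** Otherwise nested balls centred in [P] can be chosen, the [i]-th step leaving [F i]. By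
    compactness the centres cluster at a point of [P], which then lies in no [F i]. *)
Lemma compact_Baire (P : set X) (F : (set X)^nat) : compact P -> P !=set0 ->
  (forall i, closed (F i)) -> P `<=` \bigcup_i F i ->
  exists i x r, [/\ P x, 0 < r :> R & P `&` ball x r `<=` F i].
Proof.
move=> cP [x0 Px0] cF PF; apply: contrapT => noF.
(* A state is the index of the set to leave, a centre and a radius. The ball of twice the new radius
   avoids the set, so that the closure of the new ball does too. *)
have step (s : nat * (X * R)) : exists s' : nat * (X * R),
    P s.2.1 -> 0 < s.2.2 ->
    [/\ s'.1 = s.1.+1, P s'.2.1, 0 < s'.2.2 &
       ball s'.2.1 (s'.2.2 + s'.2.2) `<=` ball s.2.1 s.2.2 `\` F s.1].
  case: s => i [x r] /=.
  have [Px|nP] := pselect (P x); last by exists (i, (x, r)).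
  have [r0|nr] := pselect (0 < r); last by exists (i, (x, r)).
  have [y [Py xy Fy]] : exists y, [/\ P y, ball x (r / 2) y & ~ F i y].
    apply: contrapT => H; apply: noF; exists i, x, (r / 2); split => //.
      by rewrite divr_gt0.
    by move=> y [Py xy]; apply: contrapT => Fy; apply: H; exists y.
  have /nbhs_ballP[e /= e0 eF] : nbhs y (~` F i).
    by apply: open_nbhs_nbhs; split => //; rewrite openC.
  pose d := Num.min (r / 2) e / 2.
  have d0 : 0 < d by rewrite divr_gt0// lt_min e0 divr_gt0.
  have dd : d + d = Num.min (r / 2) e by rewrite -splitr.
  exists (i.+1, (y, d)) => _ _; split => //= z; rewrite dd => yz; split.
    rewrite (splitr r); apply: ball_triangle xy _; apply: le_ball yz.
    by rewrite ge_min lexx.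
  by apply: eF; apply: le_ball yz; rewrite ge_min lexx orbT.
have /choice[next nextP] := step.
pose s k := iter k next (0%N, (x0, 1)).
have sP k : [/\ (s k).1 = k, P (s k).2.1 & 0 < (s k).2.2].
  elim: k => [//|k [k1 Pk rk]]; rewrite /s iterS -/(s k).
  by have [-> ? ? _] := nextP (s k) Pk rk; rewrite k1.
have sS k : ball (s k.+1).2.1 ((s k.+1).2.2 + (s k.+1).2.2) `<=`
    ball (s k).2.1 (s k).2.2 `\` F k.
  have [k1 Pk rk] := sP k.
  by have [_ _ _] := nextP (s k) Pk rk; rewrite k1; exact.
have s_in k l : ball (s k).2.1 (s k).2.2 (s (k + l)%N).2.1.
  elim: l k => [|l IH] k.
    by rewrite addn0; have [_ _ ?] := sP k; exact: ballxx.
  rewrite -addSnnS; have h := IH k.+1; have [_ _ r0] := sP k.+1.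
  have : ball (s k.+1).2.1 ((s k.+1).2.2 + (s k.+1).2.2) (s (k.+1 + l)%N).2.1.
    by apply: le_ball h; rewrite lerDl ltW.
  by move=> /sS[].
pose u k := (s k).2.1.
have [y [Py uy]] : P `&` cluster (u @ \oo) !=set0.
  by apply: cP; exists 0%N => // k _; have [] := sP k.
have [i _ Fy] := PF _ Py.
have : closure (ball (s i.+1).2.1 (s i.+1).2.2) y.
  move=> B yB; rewrite setIC; have := uy (ball (s i.+1).2.1 (s i.+1).2.2) B.
  rewrite setIC; apply => //.
  exists i.+1 => // k /= ik; have := s_in i.+1 (k - i.+1)%N.
  by rewrite subnKC.
have [_ _ ri0] := sP i.+1.
move=> /(_ _ (nbhsx_ballx y _ ri0))[z [iz yz]].
have := ball_triangle iz (ball_sym yz).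
by move=> /sS[_].
Qed.

End CompactBaire.

(* The library proves compact_cover for pointed spaces only. *)
Lemma compact_cover_unpointed (X : topologicalType) (x0 : X) (A : set X) :
  compact A -> cover_compact A.
Proof.
pose T : ptopologicalType :=
  HB.pack (X : Type) (Topological.class X) (isPointed.Build X x0).
by move=> cA; have := cA; rewrite -[compact A]/(@compact T A) compact_cover.
Qed.

(** * Bump functions and distances to complements *)

Section MetricFunctions.
Context {R : realType} {X : metricType R}.
Implicit Types (x y : X) (U : set X) (r : R).
Local Open Scope ring_scope.

Lemma nonexpansive_continuous (u : X -> R) :
  (forall x y, u x <= u y + mdist x y) -> continuous u.
Proof.
move=> u1 x; apply/cvgrPdist_lt => e e0.
apply/nbhs_ballP; exists e => //= y; rewrite ballEmdist/= => xy.
rewrite ltr_norml; have := u1 x y; have := u1 y x; rewrite (metric_sym y x).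
by move: xy => /= ? ? ?; apply/andP; split; lra.
Qed.

Lemma mdist_continuous x : continuous (mdist x : X -> R).
Proof.
apply: nonexpansive_continuous => y z.
by rewrite (metric_sym y z); exact: metric_triangle.
Qed.

Lemma open_mball x r : open (ball x r).
Proof.
rewrite openE => y xy; apply/nbhs_ballP; exists (r - mdist x y).
  by move: xy; rewrite ballEmdist/= subr_gt0.
move=> z; rewrite !ballEmdist/= => yz.
by rewrite (le_lt_trans (metric_triangle _ y _))// -ltrBrDl.
Qed.

Definition bump x r y : R := Num.max 0 (Num.min 1 (2 - mdist x y / r)).

Lemma bump_ge0 x r y : 0 <= bump x r y.
Proof. by rewrite le_max lexx. Qed.

Lemma bump_le1 x r y : bump x r y <= 1.
Proof. by rewrite ge_max ler01 ge_min lexx. Qed.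

Lemma bump_eq1 x r y : 0 < r -> mdist x y <= r -> bump x r y = 1.
Proof.
move=> r0 xy; rewrite /bump min_l; first by rewrite max_r.
by rewrite lerBrDl -lerBrDr ler_pdivrMr//; lra.
Qed.

Lemma bump_eq0 x r y : 0 < r -> 2 * r <= mdist x y -> bump x r y = 0.
Proof.
move=> r0 xy; rewrite /bump max_l// ge_min; apply/orP; right.
by rewrite subr_le0 ler_pdivlMr.
Qed.

Lemma bump_continuous x r : continuous (bump x r).
Proof.
apply: (@max_fun_continuous _ X R (fun=> 0)); first by move=> y; exact: cvg_cst.
apply: (@min_fun_continuous _ X R (fun=> 1)); first by move=> y; exact: cvg_cst.
move=> y; apply: cvgB; first exact: cvg_cst.
by apply: cvgM; [exact: mdist_continuous|exact: cvg_cst].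
Qed.

(* The distance to the complement of U, truncated at 1. *)
Definition dist_compl U x : R := sup [set r : R | r <= 1 /\ ball x r `<=` U].

Let dist_compl_has_sup U x : has_sup [set r : R | r <= 1 /\ ball x r `<=` U].
Proof.
split; last by exists 1 => r [].
exists 0; split => // y; rewrite ballEmdist/= => xy.
by have := mdist_ge0 x y; rewrite leNgt xy.
Qed.

Lemma dist_compl_ge0 U x : 0 <= dist_compl U x.
Proof.
apply: ub_le_sup; first by have [] := dist_compl_has_sup U x.
split => // y; rewrite ballEmdist/= => xy.
by have := mdist_ge0 x y; rewrite leNgt xy.
Qed.

Lemma dist_compl_gt0 U x : open U -> U x -> 0 < dist_compl U x.
Proof.
rewrite openE => /[apply] /nbhs_ballP[r /= r0 rU].
apply: (@lt_le_trans _ _ (Num.min 1 r)); first by rewrite lt_min ltr01.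
apply: ub_le_sup; first by have [] := dist_compl_has_sup U x.
split; first by rewrite ge_min lexx.
by apply: subset_trans rU; apply: le_ball; rewrite ge_min lexx orbT.
Qed.

Lemma dist_compl_eq0 U x : ~ U x -> dist_compl U x = 0.
Proof.
move=> Ux; apply/eqP; rewrite eq_le dist_compl_ge0 andbT.
apply: ge_sup; first by have [] := dist_compl_has_sup U x.
move=> r [_ rU]; rewrite leNgt; apply/negP => r0; apply: Ux.
by apply: rU; exact: ballxx.
Qed.

Lemma dist_compl_continuous U : continuous (dist_compl U).
Proof.
apply: nonexpansive_continuous => x y.
apply: ge_sup; first by have [] := dist_compl_has_sup U x.
move=> r [r1 rU]; rewrite -lerBlDr.
apply: ub_le_sup; first by have [] := dist_compl_has_sup U y.
split; first by rewrite lerBlDr (le_trans r1)// lerDl mdist_ge0.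
move=> z; rewrite ballEmdist/= => yz; apply: rU; rewrite ballEmdist/=.
by rewrite (le_lt_trans (metric_triangle _ y _))// -ltrBrDl.
Qed.

End MetricFunctions.

(** * Perturbing continuous functions at finitely many points *)

Section CnTheory.
Context {R : realType} {X : metricType R} (cX : compact [set: X]) {n : nat}.
Local Notation Cn := (Cn R cX n).
Implicit Types f g h : Cn.
Local Open Scope ring_scope.

Lemma Cn_dist_le f g (e : R) : 0 <= e ->
  (forall x, enorm (f x - g x) <= e) -> `|f - g| <= e.
Proof. by move=> e0 fg; exact: sup_norm_le. Qed.

Lemma Cn_dist_ge f g x : enorm (f x - g x) <= `|f - g|.
Proof. exact: (enorm_le_sup_norm (f - g)). Qed.

Lemma Cn_of_continuous (u : X -> 'rV[R]_n) : continuous u ->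
  exists f, (f : X -> 'rV[R]_n) = u.
Proof.
by move=> cu; have uP : u \in @cont_pred R X n; [rewrite inE|exists (MkCn cX uP)].
Qed.

Lemma Cn_near_enorm f x (e : R) : 0 < e ->
  exists2 r : R, 0 < r & forall y, mdist x y < r -> enorm (f x - f y) < e.
Proof.
move=> e0; have := @Cn_continuous _ _ _ _ f x _ (nbhs_enorm (f x) e0).
move=> /nbhs_ballP[r /= r0 rf]; exists r => // y xy.
by apply: rf; rewrite ballEmdist.
Qed.

Lemma Cn_range_bounded f : bounded_set (range f).
Proof.
apply: compact_bounded; apply: continuous_compact => //.
exact/continuous_subspaceT/Cn_continuous.
Qed.

Lemma continuous_sum_seq (V : normedModType R) (I : Type) (s : seq I) (F : I -> X -> V) :
  (forall i, continuous (F i)) -> continuous (fun x => \sum_(i <- s) F i x).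
Proof.
move=> cF x; apply: cvg_big => [|i _]; last exact: cF.
exact: add_continuous.
Qed.

(** The factor 4 suits bumps that vanish from distance [2 r] on: no two of them are nonzero at the
    same point. *)
Lemma separation_gap (I : finType) (y : I -> X) : injective y ->
  exists2 r : R, 0 < r & forall i j, i != j -> 4 * r <= mdist (y i) (y j).
Proof.
move=> yinj.
exists (\big[Num.min/1]_(p : I * I | p.1 != p.2) (mdist (y p.1) (y p.2) / 4)).
  rewrite lt_bigmin// => -[i j] /= ij.
  by rewrite divr_gt0// mdist_gt0 (inj_eq yinj).
move=> i j ij; rewrite mulrC -ler_pdivlMr//.
exact: (bigmin_le_cond _ (j := (i, j))).
Qed.

(** Bumps around the [y i] carry the corrections [w i - f (y i)]. At most one is nonzero at each
    point, so the errors do not add up. *)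
Lemma Cn_interpolation f (I : finType) (y : I -> X) (w : I -> 'rV[R]_n) (e : R) :
  0 <= e -> injective y -> (forall i, enorm (f (y i) - w i) <= e) ->
  exists g, `|f - g| <= e /\ forall i, g (y i) = w i.
Proof.
move=> e0 yinj fw; have [r r0 ry] := separation_gap yinj.
pose b i x : R := bump (y i) r x.
have b_eq0 i j x : i != j -> b i x != 0 -> b j x = 0.
  move=> ij bi; have xi : mdist (y i) x < 2 * r.
    by rewrite ltNge; apply: contra_neqN bi; exact: bump_eq0.
  apply: bump_eq0 => //; have := metric_triangle (y i) x (y j).
  by have := ry _ _ ij; rewrite (metric_sym x (y j)); lra.
have [|g gE] := Cn_of_continuous (u :=
    fun x => f x + \sum_(i <- index_enum I) b i x *: (w i - f (y i))).
  move=> x; apply: cvgD; first exact: Cn_continuous.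
  apply: continuous_sum_seq => i z; apply: cvgZr_tmp; exact: bump_continuous.
have gi i x : b i x != 0 -> g x = f x + b i x *: (w i - f (y i)).
  move=> bi; rewrite gE (bigD1 i)//= big1 ?addr0// => j ji.
  by rewrite (b_eq0 i) ?scale0r// eq_sym.
exists g; split => [|i].
  apply: Cn_dist_le => // x.
  have [[i bi]|nb] := pselect (exists i, b i x != 0).
    rewrite (gi i)// opprD addrA subrr add0r -scalerN opprB enormZ.
    rewrite ger0_norm ?bump_ge0// (le_trans _ (fw i))// ler_piMl ?enorm_ge0//.
    exact: bump_le1.
  rewrite gE big1 ?addr0 ?subrr ?enorm0// => i _.
  have [->|bi] := eqVneq (b i x) 0; first by rewrite scale0r.
  by case: nb; exists i.
have b1 : b i (y i) = 1 by apply: bump_eq1 => //; rewrite mdistxx ltW.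
by rewrite (gi i) b1 ?oner_neq0// scale1r addrC subrK.
Qed.

End CnTheory.

(** * Generic images have packing dimension at least [n] *)

Section GenericDimension.
Context {R : realType} {X : metricType R} (cX : compact [set: X]) {n : nat}.
Local Notation Cn := (Cn R cX n).
Implicit Types f g h : Cn.
Local Open Scope ring_scope.

(** Finite evidence, at one scale [d < e], that [f] spreads [Q] over nearly [n] dimensions. The
    strict separation makes it an open condition on [f]. *)
Definition spread (Q : set X) (e : R) : set Cn := [set f | exists d L,
  [/\ 0 < d < e, (0 < L)%N, (n%:R - e) * - ln d <= ln L%:R &
    exists p : 'I_L -> X, (forall i, Q (p i)) /\
      forall i j, i != j -> 3 * d < enorm (f (p i) - f (p j))]].

Lemma spread_open Q e : open (spread Q e).
Proof.
rewrite openE => f [d [L [de L0 dL [p [pQ psep]]]]].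
pose G i j := [set g : Cn | i != j -> 3 * d < enorm (g (p i) - g (p j))].
suff : nbhs f [set g | forall i j, G i j g].
  by apply: filterS => g gp; exists d, L; split => //; exists p.
apply: (@filter_forall _ 'I_L (fun i => [set g | forall j, G i j g]) (nbhs f)
  (nbhs_filter f)) => i.
apply: (@filter_forall _ 'I_L (G i) (nbhs f) (nbhs_filter f)) => j.
have [->|ij] := eqVneq i j.
  by apply: filterE => g; rewrite /G /= eqxx.
pose s := (enorm (f (p i) - f (p j)) - 3 * d) / 2.
have s0 : 0 < s by rewrite divr_gt0// subr_gt0 psep.
apply/nbhs_ballP; exists s => //= g; rewrite -ball_normE/= => fg _.
have := enorm_triangle (g (p i)) (f (p i)) (f (p j)).
have := enorm_triangle (g (p j)) (g (p i)) (f (p j)).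
have := Cn_dist_ge f g (p i); have := Cn_dist_ge f g (p j).
rewrite (enormB (f (p j))); move: fg; rewrite /s; lra.
Qed.

Lemma infinite_ord_inj (T : choiceType) (A : set T) L : infinite_set A ->
  exists2 y : 'I_L -> T, injective y & forall i, A (y i).
Proof.
move=> /(infinite_set_fset L)[B BA LB].
exists (fun i => tnth (in_tuple (finmap.enum_fset B)) (widen_ord LB i)).
  move=> i j /(tuple_uniqP (in_tuple (finmap.enum_fset B)) (finmap.fset_uniq B)).
  by move=> /(congr1 val)/= /val_inj.
by move=> i; apply: BA => /=; exact: mem_tnth.
Qed.

(** Close to [x0] the values of [f] stay near [f x0], so at [M ^ n] points of [Q] they can be moved
    to a grid around [f x0]. *)
Lemma spread_dense (Q : set X) e x0 : 0 < e ->
  (forall r : R, 0 < r -> infinite_set (Q `&` ball x0 r)) -> dense (spread Q e).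
Proof.
move=> e0 Qinf O [f Of] oO.
have /nbhs_ballP[s /= s0 sO] : nbhs f O by exact: open_nbhs_nbhs.
have s4 : 0 < s / 4 by rewrite divr_gt0.
have [r r0 fr] := Cn_near_enorm f x0 s4.
pose t : R := s / 4 / n.+1%:R.
have t0 : 0 < t by rewrite divr_gt0.
(* [t / 6], half of the [t / 3] of the grid, turns its separation into the strict one of
   [spread]. *)
have t6 : 0 < t / 6 by rewrite divr_gt0.
have [M [M0 Me ML]] := grid_rate n t6 e0.
have [v [vf vsep]] := separated_ball (f x0) t0 M0.
have [y yinj yQ] := infinite_ord_inj (M ^ n)%N (Qinf _ r0).
have [|i|g [fg gv]] := @Cn_interpolation _ _ cX _ f _ y v (s / 2) _ yinj.
- by rewrite divr_ge0// ltW.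
- have /ltW h1 : enorm (f x0 - f (y i)) < s / 4.
    by apply: fr; have [_] := yQ i; rewrite ballEmdist.
  have h2 : enorm (f x0 - v i) <= s / 4.
    rewrite enormB (le_trans (enorm_le_normr _))//.
    rewrite (le_trans (ler_wpM2l _ (vf i)))// /t mulrCA ler_piMr ?(ltW s4)//.
    by rewrite ler_pdivrMr// mul1r ler_nat.
  have := enorm_triangle (f x0) (f (y i)) (v i); rewrite (enormB _ (f x0)); lra.
exists g; split; first by apply: sO; rewrite -ball_normE/=; lra.
have d0 : 0 < t / 6 / M%:R by rewrite divr_gt0// ltr0n.
exists (t / 6 / M%:R), (M ^ n)%N; split; first by rewrite d0.
- by rewrite expn_gt0 M0.
- by [].
exists y; split => [i|i j /vsep vij]; first by have [] := yQ i.
rewrite !gv; apply: lt_le_trans vij.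
rewrite -subr_gt0.
have -> : 3 * (t / 3 / M%:R) - 3 * (t / 6 / M%:R) = 3 * (t / 6 / M%:R).
  by field; rewrite pnatr_eq0 -lt0n.
by rewrite mulr_gt0.
Qed.

Lemma metric_countable_base (x0 : X) : exists V : (set X)^nat,
  (forall i, open (V i)) /\
  forall x (r : R), 0 < r -> exists2 i, V i x & V i `<=` ball x r.
Proof.
have cov (k : nat) : exists s : seq X, forall x, exists2 y, y \in s &
    ball y (k.+1%:R^-1 : R) x.
  have k0 : (0 : R) < k.+1%:R^-1 by rewrite invr_gt0.
  have := @compact_cover_unpointed X x0 _ cX X setT (fun y => ball y k.+1%:R^-1).
  case=> [y _|x _|D _ XD]; first exact: open_mball.
    by exists x => //; exact: ballxx.
  by exists (finmap.enum_fset D) => x; have [y yD yx] := XD x I; exists y.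
have /choice[s sP] := cov.
pose W (q : nat * nat) : set X := ball (nth x0 (s q.1) q.2) (q.1.+1%:R^-1 : R).
exists (fun i => W (odflt (0%N, 0%N) (unpickle i))); split => [i|x r r0].
  exact: open_mball.
pose k := Num.truncn (r / 2)^-1.
have kr : k.+1%:R^-1 < r / 2 by rewrite invf_plt ?posrE ?divr_gt0// truncnS_gt.
have [y ys yx] := sP k x.
exists (pickle (k, index y (s k))); rewrite pickleK/= /W/= nth_index//.
move=> z yz; rewrite (splitr r); apply: ball_triangle (le_ball (ltW kr) yz).
exact/ball_sym/(le_ball (ltW kr)).
Qed.

(* As in the Cantor-Bendixson theorem, P is what remains of X after removing
   every countable basic open set. *)
Lemma uncountable_kernel : ~ countable [set: X] ->
  exists P : set X, [/\ closed P, P !=set0 &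
    forall x (r : R), P x -> 0 < r -> infinite_set (P `&` ball x r)].
Proof.
move=> uX.
have /set0P[x0 _] : [set: X] != set0.
  by apply: contra_notN uX => /eqP ->; exact: countable0.
have [V [oV Vb]] := metric_countable_base x0.
pose N := \bigcup_(i in [set i | countable (V i)]) V i.
have cN : countable N by apply: bigcup_countable.
(* If only finitely many points of [U] were left, [U] would be countable. A basic set around a point
   outside [N] is uncountable by the choice of [N]. *)
have inf U : ~ countable U -> infinite_set (~` N `&` U).
  move=> uU /finite_set_countable cU; apply: uU.
  apply: (@sub_countable _ _ _ (\bigcup_b if b then N else ~` N `&` U)).
    apply: subset_card_le => x Ux.
    by have [Nx|Nx] := pselect (N x); [exists true|exists false].
  by apply: bigcup_countable => // -[].
exists (~` N); split.
- by rewrite closedC; exact: bigcup_open.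
- have := inf _ uX; rewrite setIT => /infinite_setN0; exact.
- move=> x r Nx r0; have [i Vx Vr] := Vb x r r0.
  have := inf (V i) (fun c => Nx (ex_intro2 _ _ i c Vx)).
  by apply: sub_infinite_set => y [Ny Vy]; split => //; exact: Vr.
Qed.

Lemma meagre_packing_dim_lt : ~ countable [set: X] ->
  meagre [set f : Cn | (packing_dim (range f) < n%:R%:E)%E].
Proof.
move=> uX; have [P [cP [x0 Px0] Pinf]] := uncountable_kernel uX.
have [V [oV Vb]] := metric_countable_base x0.
(* The premise makes the condition void for basic sets that miss [P], so that every [O q] is open
   and dense. *)
pose O (q : nat * nat) : set Cn := [set f | P `&` V q.1 !=set0 ->
  spread (P `&` V q.1) (q.2.+1%:R^-1) f].
have Ood q : open (O q) /\ dense (O q).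
  have [[x [Px Vx]]|nPV] := pselect (P `&` V q.1 !=set0); last first.
    suff -> : O q = setT by split; [exact: openT|move=> U U0 _; rewrite setIT].
    by apply/seteqP; split => f // _ /nPV.
  have -> : O q = spread (P `&` V q.1) (q.2.+1%:R^-1).
    by apply/seteqP; split => f; [apply; exists x|move=> ? _].
  split; first exact: spread_open.
  apply: (@spread_dense _ _ x); first by rewrite invr_gt0.
  move=> r r0.
  have /nbhs_ballP[s /= s0 sV] : nbhs x (V q.1) by exact: open_nbhs_nbhs.
  have rs0 : 0 < Num.min r s by rewrite lt_min r0.
  apply: sub_infinite_set (Pinf x _ Px rs0) => y [Py xy].
  split; first split => //.
    by apply: sV; apply: le_ball xy; rewrite ge_min lexx orbT.
  by apply: le_ball xy; rewrite ge_min lexx.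
pose O' k := O (odflt (0%N, 0%N) (unpickle k)).
have := @meagre_setC_bigcap _ O' (fun k => Ood _); apply: meagreS.
move=> f /= fn fO; move: fn; apply/negP; rewrite -leNgt.
have {}fO q : O q f by have := fO (pickle q) I; rewrite /O' pickleK.
apply: packing_dim_ge => G fG.
(* One closure of a [G i] contains the image of a whole piece of [P]; the spread of a basic part of
   that piece then bounds the covering numbers of [G i] from below. *)
have [|i|y Py|i [x [r [Px r0 PrF]]]] := @compact_Baire _ _ P
    (fun i => f @^-1` closure (G i)) _ (ex_intro _ x0 Px0).
- exact: subclosed_compact cP cX _.
- apply: preimage_closed; last exact: closed_closure.
  by move=> y _; exact: Cn_continuous.
- have [i _ ?] := fG (f y) (ex_intro2 _ _ y I erefl).
  by exists i => //; exact: subset_closure.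
exists i; apply: upper_box_dim_ge => e e0.
have [j Vx Vr] := Vb x r r0.
pose k := Num.truncn e^-1.
have ke : k.+1%:R^-1 < e by rewrite invf_plt ?posrE// truncnS_gt.
have k1 : (k.+1%:R^-1 : R) <= 1 by rewrite invf_le1// ler1n.
have [d [L [/andP[d0 dk] L0 dL [p [pQ psep]]]]] : spread (P `&` V j) (k.+1%:R^-1) f.
  by apply: (fO (j, k)); exists x.
exists d, L; split => //; first by rewrite d0 (lt_trans dk).
  apply: le_trans dL; rewrite ler_wpM2r ?lerD2l ?lerN2 ?(ltW ke)//.
  by rewrite oppr_ge0 ln_le0// (le_trans (ltW dk)).
apply: (@covering_number_ge _ _ _ id) => //.
exists (f \o p); split => [a|a b ab] /=; last exact/ltW/psep.
by rewrite image_id; apply: PrF; have [Pp Vp] := pQ a; split => //; exact: Vr.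
Qed.

End GenericDimension.

(** * Density of functions whose images have small box dimension *)

Section SmallDimension.
Context {R : realType} {X : metricType R} (cX : compact [set: X]) {n : nat}.
Local Notation Cn := (Cn R cX n).
Implicit Types f g h : Cn.
Local Open Scope ring_scope.

Lemma enorm_sum (I : Type) (s : seq I) (P : pred I) (F : I -> 'rV[R]_n) :
  enorm (\sum_(i <- s | P i) F i) <= \sum_(i <- s | P i) enorm (F i).
Proof.
elim/big_ind2 : _ => [|u a v b ua vb|//]; first by rewrite enorm0.
by rewrite (le_trans (enormD _ _))// lerD.
Qed.

(* The set F lies in the union of the simplices of dimension at most d with
   vertices among the w j. *)
Lemma upper_box_dim_le_simplices d l (w : 'I_l -> 'rV[R]_n) (F : set 'rV[R]_n) :
  (forall y, F y -> exists j0 (s : seq 'I_l) (c : 'I_l -> R),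
    [/\ (size s <= d)%N, forall j, 0 <= c j <= 1 &
        y = w j0 + \sum_(j <- s) c j *: (w j - w j0)]) ->
  (upper_box_dim F <= d%:R%:E)%E.
Proof.
move=> Fw.
pose phi (a : 'I_l * {ffun 'I_d -> 'I_l}) (t : 'rV[R]_d) : 'rV[R]_n :=
  w a.1 + \sum_(i < d) t ord0 i *: (w (a.2 i) - w a.1).
pose B : R := \sum_j \sum_k enorm (w j - w k).
have wB j k : enorm (w j - w k) <= B.
  rewrite /B (bigD1 j)//= (bigD1 k)//= -addrA lerDl addr_ge0// sumr_ge0// => i _.
    exact: enorm_ge0.
  by apply: sumr_ge0 => i' _; exact: enorm_ge0.
apply: (@upper_box_dim_le_cubes _ _ _ _ phi (d%:R * B)).
  move=> a t u; rewrite /phi opprD addrACA subrr add0r -sumrB.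
  rewrite (le_trans (enorm_sum _ _ _))//.
  apply: (@le_trans _ _ (\sum_(i < d) B * `|t - u|)); last first.
    by rewrite sumr_const card_ord -mulrA mulr_natl.
  apply: ler_sum => i _; rewrite -scalerBl enormZ mulrC ler_pM ?enorm_ge0//.
  by have := normr_coord_le (t - u) i; rewrite !mxE.
move=> y /Fw[j0 [s [c [sd c01 ->]]]].
(* The list [s] is padded with [j0] to length [d], with coefficients 0. *)
pose a : {ffun 'I_d -> 'I_l} := [ffun i : 'I_d => nth j0 s i].
exists (j0, a) => //.
exists (\row_(i < d) if (i < size s)%N then c (nth j0 s i) else 0).
  by move=> i; rewrite mxE; case: ifP; rewrite ?lexx ?ler01.
rewrite /phi/=; congr (_ + _).
rewrite (big_nth j0) big_mkord.
rewrite (big_ord_widen _ (fun i => c (nth j0 s i) *: (w (nth j0 s i) - w j0)) sd).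
rewrite [RHS]big_mkcond/=; apply: eq_bigr => i _; rewrite mxE ffunE.
by case: ifP; rewrite ?scale0r.
Qed.

Lemma Cn_open_enorm f y (e : R) : open [set x | enorm (f y - f x) < e].
Proof.
rewrite openE => x /= fx; have e0 : 0 < e - enorm (f y - f x) by rewrite subr_gt0.
have [r r0 fr] := Cn_near_enorm f x e0.
apply/nbhs_ballP; exists r => // z; rewrite ballEmdist => /fr fz /=.
by rewrite (le_lt_trans (enorm_triangle (f x) _ _))// -ltrBrDl.
Qed.

Lemma finite_value_cover (x0 : X) f (e : R) : 0 < e -> exists s : seq X,
  forall x, exists2 y, y \in s & enorm (f y - f x) < e.
Proof.
move=> e0.
have := @compact_cover_unpointed X x0 _ cX X setT
  (fun y => [set x | enorm (f y - f x) < e]).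
case=> [y _|x _|D _ XD].
- exact: Cn_open_enorm.
- by exists x => //=; rewrite subrr enorm0.
- by exists (finmap.enum_fset D) => x; have [y yD yx] := XD x I; exists y.
Qed.

Lemma dense_upper_box_dim_le (x0 : X) d : covering_dim_le X d ->
  dense [set f : Cn | (upper_box_dim (range f) <= d%:R%:E)%E].
Proof.
move=> Xd O [f Of] oO.
have /nbhs_ballP[s /= s0 sO] : nbhs f O by exact: open_nbhs_nbhs.
have s2 : 0 < s / 2 by rewrite divr_gt0.
have [xs xsP] := finite_value_cover x0 f s2.
have [i||l [V [oV VT VU Vd]]] := Xd (size xs)
    (fun i => [set x | enorm (f (nth x0 xs i) - f x) < s / 2]).
- exact: Cn_open_enorm.
- apply/seteqP; split => // x _; have [y ys yx] := xsP x.
  have yi : (index y xs < size xs)%N by rewrite index_mem.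
  by exists (Ordinal yi) => //=; rewrite nth_index.
(* The single value [f (c j)] approximates [f] on all of [V j] and becomes the vertex attached to
   [V j]. *)
have /choice[c cV] (j : 'I_l) : exists c, forall x, V j x -> enorm (f c - f x) < s / 2.
  by have [i Vi] := VU j; exists (nth x0 xs i) => x /Vi.
pose p j x : R := dist_compl (V j) x.
pose S x : R := \sum_j p j x.
have p_gt0 x : exists j, V j x /\ 0 < p j x.
  have : [set: X] x by []; rewrite -VT => -[j _ Vj]; exists j; split => //.
  exact: dist_compl_gt0.
have S0 x : 0 < S x.
  have [j [_ pj]] := p_gt0 x; rewrite /S (bigD1 j)//= ltr_pwDl//.
  by apply: sumr_ge0 => i _; exact: dist_compl_ge0.
have cS : continuous S.
  by apply: (@continuous_sum_seq _ _ R) => j; exact: dist_compl_continuous.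
(* The [p j / S] form a partition of unity vanishing off [V j], so [g x] averages vertices within
   [s / 2] of [f x]. *)
have [|g gE] := Cn_of_continuous cX (u :=
    fun x => \sum_j (p j x / S x) *: f (c j)).
  apply: continuous_sum_seq => j x; apply: cvgZr_tmp; apply: cvgM.
    exact: dist_compl_continuous.
  by apply: cvgV; [rewrite gt_eqF|exact: cS].
have q01 j x : 0 <= p j x / S x <= 1.
  rewrite divr_ge0 ?dist_compl_ge0 ?(ltW (S0 x))//= ler_pdivrMr// mul1r.
  rewrite /S (bigD1 j)//= lerDl; apply: sumr_ge0 => i _; exact: dist_compl_ge0.
have q1 x : \sum_j p j x / S x = 1 by rewrite -mulr_suml -/(S x) divff// gt_eqF.
exists g; split.
  apply: sO; rewrite -ball_normE/=.
  suff : `|f - g| <= s / 2 by lra.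
  apply: Cn_dist_le => [|x]; first exact: ltW.
  have -> : f x - g x = \sum_j (p j x / S x) *: (f x - f (c j)).
    under eq_bigr do rewrite scalerBr.
    by rewrite sumrB -scaler_suml q1 scale1r gE.
  rewrite (le_trans (enorm_sum _ _ _))//.
  have -> : s / 2 = \sum_j p j x / S x * (s / 2) by rewrite -mulr_suml q1 mul1r.
  apply: ler_sum => j _.
  have /andP[q0 _] := q01 j x.
  rewrite enormZ ger0_norm//.
  have [Vj|nVj] := pselect (V j x).
    by rewrite ler_wpM2l// enormB ltW// cV.
  by rewrite /p dist_compl_eq0// !mul0r.
apply: (@upper_box_dim_le_simplices d l (fun j => f (c j))) => _ [x _ <-].
have [j0 [Vj0 pj0]] := p_gt0 x.
(* The order of the cover leaves at most [d + 1] nonzero weights at [x], hence at most [d] besides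
   that of the base vertex [j0]. *)
pose J := [set j | p j x != 0]%SET.
exists j0, (enum (J :\ j0)%SET), (fun j => p j x / S x); split => //.
  rewrite -cardE -ltnS; have j0J : j0 \in J by rewrite inE gt_eqF.
  move: (cardsD1 j0 J); rewrite j0J add1n => <-.
  rewrite leqNgt; apply/negP => /Vd.
  rewrite -subset0 => /(_ x); apply => j /=; rewrite inE => pj.
  by apply: contrapT => /dist_compl_eq0 pj0'; move: pj; rewrite /p pj0' eqxx.
have fj0 : f (c j0) = \sum_j (p j x / S x) *: f (c j0).
  by rewrite -scaler_suml q1 scale1r.
rewrite gE big_enum/= [X in _ = X + _]fj0.
have -> : \sum_(j in (J :\ j0)%SET) (p j x / S x) *: (f (c j) - f (c j0)) =
    \sum_j (p j x / S x) *: (f (c j) - f (c j0)).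
  rewrite [RHS](bigID (mem (J :\ j0)%SET))/= [X in _ = _ + X]big1 ?addr0// => j.
  rewrite !inE negb_and negbK => /orP[/eqP->|/negPn/eqP ->].
    by rewrite subrr scaler0.
  by rewrite mul0r scale0r.
rewrite -big_split/=; apply: eq_bigr => j _.
by rewrite scalerBr addrC subrK.
Qed.

End SmallDimension.

(** * Projection to the first coordinates, and Baire's theorem in the target *)

Section Projection.
Context {R : realType} {m n : nat} (mn : (m <= n)%N).
Local Open Scope ring_scope.

Definition rV_proj (u : 'rV[R]_n) : 'rV[R]_m := \row_i u ord0 (widen_ord mn i).

Lemma rV_proj_nonexpansive u v : enorm (rV_proj u - rV_proj v) <= enorm (u - v).
Proof.
rewrite ler_sqrt ?sumsq_ge0//.
rewrite [leRHS](bigID (fun i : 'I_n => (i < m)%N))/= big_ord_narrow/=.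
rewrite (eq_bigr (fun i => (u - v) ord0 (widen_ord mn i) ^+ 2)) => [|i _].
  by rewrite lerDl; apply: sumr_ge0 => i _; exact: sqr_ge0.
by rewrite !mxE.
Qed.

End Projection.

(** The complements of the closures are open and dense. *)
Lemma rV_Baire (R : realType) (m : nat) (F : (set 'rV[R]_m)^nat) :
  (forall i, (closure (F i))^° = set0) -> forall c (s : R), (0 < s)%R ->
  exists2 v, (`|c - v| < s)%R & forall i, ~ F i v.
Proof.
move=> F0 c s s0.
pose U : completeNormedModType R :=
  HB.pack 'rV[R]_m (NormedModule.class 'rV[R]_m) (Complete.class 'rV[R]_m).
have [i||v [cv vF]] := @Baire R U (fun i => ~` closure (F i)) _ (ball (c : U) s) _
    (ball_open _ _).
- split; first by rewrite openC; exact: closed_closure.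
  move=> O [x Ox] oO; apply: contrapT => OF.
  suff : (closure (F i))^° x by rewrite F0.
  have : nbhs x O by exact: open_nbhs_nbhs.
  by apply: filterS => y Oy; apply: contrapT => yF; apply: OF; exists y.
- by exists c; exact: ballxx.
exists v => [|i Fv]; first by move: cv; rewrite -ball_normE.
by apply: (vF i) => //; exact: subset_closure.
Qed.

(** * Avoiding common zeros, and the covering dimension *)

Section Avoidance.
Context {R : realType} {X : metricType R} (cX : compact [set: X]).
Local Open Scope ring_scope.

(* Every m-tuple of continuous functions can be perturbed arbitrarily little so
   as to have no common zero in K. *)
Definition avoidable (m : nat) (K : set X) := forall (g : nat -> X -> R) (d : R),
  (forall i, continuous (g i)) -> 0 < d -> exists h : 'I_m -> X -> R,
    [/\ forall i, continuous (h i),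
        forall i x, K x -> `|h i x - g i x| <= d &
        forall x, K x -> exists i, h i x != 0].

Lemma avoidableS m K K' : K' `<=` K -> avoidable m K -> avoidable m K'.
Proof.
move=> K'K aK g d cg d0; have [h [ch hg h0]] := aK g d cg d0.
by exists h; split => // [i x /K'K|x /K'K]; [exact: hg|exact: h0].
Qed.

Lemma row_continuous n (u : nat -> X -> R) : (forall i, continuous (u i)) ->
  continuous (fun x => \row_(i < n) u i x : 'rV[R]_n).
Proof.
move=> cu; have -> : (fun x => \row_(i < n) u i x : 'rV[R]_n) =
    (fun x => \sum_(i < n) u i x *: 'e_i).
  apply/funext => x; rewrite [LHS]row_sum_delta; apply: eq_bigr => i _.
  by rewrite mxE.
by apply: continuous_sum_seq => i x; apply: cvgZr_tmp; exact: cu.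
Qed.

Lemma Cn_coord_continuous n (f : Cn R cX n) j :
  continuous (fun x => f x ord0 j).
Proof.
move=> x; apply/cvgrPdist_lt => e e0; have [r r0 fr] := Cn_near_enorm f x e0.
apply/nbhs_ballP; exists r => // y; rewrite ballEmdist => /fr.
by apply: le_lt_trans; have := normr_coord_le_enorm (f x - f y) j; rewrite !mxE.
Qed.

(* Near x0 the function f0 is almost constant, so it can be replaced there by
   f0 x0 + e G with G = (g 0, g 1, ...), and that by some f whose image has
   packing dimension less than m. By Baire's theorem the first m coordinates of
   f miss a point c close to those of f0 x0. *)
Lemma avoidable_local m n (mn : (m <= n)%N) (f0 : Cn R cX n) (r0 : R) :
  0 < r0 ->
  ball f0 r0 `<=`
    closure [set f : Cn R cX n | (packing_dim (range f) < m%:R%:E)%E] ->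
  forall x0, exists2 r : R, 0 < r & avoidable m (ball x0 r).
Proof.
move=> r00 f0A x0.
have r04 : 0 < r0 / 4 by rewrite divr_gt0.
have [r r0' f0r] := Cn_near_enorm f0 x0 r04.
have r2 : 0 < r / 2 by rewrite divr_gt0.
exists (r / 2) => // g d cg d0.
have [G GE] := Cn_of_continuous cX (@row_continuous n g cg).
(* Adding [e G] moves a function by at most [r0 / 4]; the [+ 1] keeps the denominator positive. *)
pose e : R := r0 / 4 / (`|G| + 1).
have G1 : 0 < `|G| + 1 by rewrite ltr_wpDl.
have e0 : 0 < e by rewrite divr_gt0.
have eG : e * `|G| <= r0 / 4.
  by rewrite /e mulrAC ler_pdivrMr// ler_wpM2l ?(ltW r04)// lerDl.
(* The bump freezes [f0] at [f0 x0] on the ball of radius [r / 2] and is nonzero only within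
   distance [r], where this costs less than [r0 / 4]. *)
have [|h hE] := Cn_of_continuous cX (u := fun x =>
    f0 x + bump x0 (r / 2) x *: (f0 x0 - f0 x) + e *: G x).
  move=> x; apply: cvgD; last by apply: cvgZl_tmp; exact: Cn_continuous.
  apply: cvgD; first exact: Cn_continuous.
  apply: cvgZ; first exact: bump_continuous.
  by apply: cvgB; [exact: cvg_cst|exact: Cn_continuous].
have hK x : ball x0 (r / 2) x -> h x = f0 x0 + e *: G x.
  rewrite ballEmdist/= => /ltW xr.
  by rewrite hE bump_eq1// scale1r [f0 x + _]addrC subrK.
have f0h : ball f0 r0 h.
  rewrite -ball_normE/=; suff : `|f0 - h| <= r0 / 4 + r0 / 4 by lra.
  apply: Cn_dist_le => [|x]; first by rewrite addr_ge0// ltW.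
  have -> : f0 x - h x = - (bump x0 (r / 2) x *: (f0 x0 - f0 x)) - e *: G x.
    by rewrite hE -addrA opprD addrA subrr add0r opprD.
  rewrite (le_trans (enormD _ _))// lerD// enormN enormZ.
    rewrite ger0_norm ?bump_ge0//.
    have [xr|xr] := leP r (mdist x0 x).
      by rewrite bump_eq0 ?mul0r ?(ltW r04)// mulrC divfK.
    rewrite (@le_trans _ _ (enorm (f0 x0 - f0 x)))//.
      by rewrite ler_piMl ?bump_le1// enorm_ge0.
    exact/ltW/f0r.
  rewrite (gtr0_norm e0) (le_trans _ eG)// ler_wpM2l ?(ltW e0)//.
  exact: (enorm_le_sup_norm G).
(* Two errors below [s] occur, from [f] against [h] and from [c] against [f0 x0]; divided by [e]
   they add up to at most [d]. *)
pose s : R := e * d / 2.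
have s0 : 0 < s by rewrite divr_gt0// mulr_gt0.
have [f [fA hf]] := f0A _ f0h _ (nbhsx_ballx h _ s0).
have {}hf x : enorm (h x - f x) < s.
  by rewrite (le_lt_trans (Cn_dist_ge h f x))//; move: hf; rewrite -ball_normE.
have [H fH Hm] := packing_dim_lt fA.
have [|c cs cH] := @rV_Baire R m (fun i => rV_proj mn @` H i) _
    (rV_proj mn (f0 x0)) s s0.
  by move=> i; apply: interior_closure_eq0 (Hm i); exact: rV_proj_nonexpansive.
pose w i := widen_ord mn i.
(* A common zero at [x] would make [c] the projection of [f x], which lies in some [H i]. *)
exists (fun i x => (f x ord0 (w i) - c ord0 i) / e); split.
- move=> i x; apply: cvgM; last exact: cvg_cst.
  apply: cvgB; last exact: cvg_cst.
  exact: Cn_coord_continuous.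
- move=> i x Kx.
  have -> : (f x ord0 (w i) - c ord0 i) / e - g i x =
      (f x ord0 (w i) - c ord0 i - e * g i x) / e.
    by rewrite [RHS]mulrBl [X in _ = _ - X]mulrAC divff ?mul1r// gt_eqF.
  rewrite normrM normfV (gtr0_norm e0) ler_pdivrMr//.
  have h1 : `|h x ord0 (w i) - f x ord0 (w i)| < s.
    have := normr_coord_le_enorm (h x - f x) (w i); rewrite !mxE => /le_lt_trans.
    exact.
  have h2 : `|f0 x0 ord0 (w i) - c ord0 i| < s.
    have := normr_coord_le (rV_proj mn (f0 x0) - c) i; rewrite !mxE => /le_lt_trans.
    exact.
  move: h1; rewrite hK// GE !mxE/= => h1.
  move: h1 h2; rewrite !ltr_norml ler_norml /s.
  move=> /andP[? ?] /andP[? ?]; apply/andP; split; lra.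
move=> x Kx; apply: contrapT => nz.
have [i _ Hi] := fH (f x) (ex_intro2 _ _ x I erefl).
apply: (cH i); exists (f x) => //; apply/rowP => j; rewrite mxE.
apply/eqP; rewrite -subr_eq0; apply: contrapT => /negP fc; apply: nz; exists j.
by rewrite mulf_neq0// invr_eq0 gt_eqF.
Qed.

Lemma open_lt (u v : X -> R) : continuous u -> continuous v ->
  open [set x | u x < v x].
Proof.
move=> cu cv; have -> : [set x | u x < v x] =
    (fun x => v x - u x) @^-1` [set y | 0 < y].
  by apply/seteqP; split => x /=; rewrite subr_gt0.
apply: open_comp; last exact: open_gt.
by move=> x _; apply: cvgB; [exact: cv|exact: cu].
Qed.

(** By compactness the sum has a positive minimum, [3 d (#|I| + 1)] for the [d] chosen, out of reach
    if all terms are at most [2 d]. *)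
Lemma sum_lower_bound (x0 : X) (I : finType) (p : I -> X -> R) :
  (forall i, continuous (p i)) -> (forall x, 0 < \sum_i p i x) ->
  exists2 d : R, 0 < d & forall x, exists i, 2 * d < p i x.
Proof.
move=> cp p0.
have [|||x1 _ x1P] := @compact_EVT_min X R (fun x => \sum_i p i x) [set: X].
- by exists x0.
- exact: cX.
- by apply: continuous_subspaceT; exact: (@continuous_sum_seq _ _ R).
pose d := (\sum_i p i x1) / (3 * #|I|.+1%:R).
have N0 : (0 : R) < 3 * #|I|.+1%:R by rewrite mulr_gt0.
have d0 : 0 < d by rewrite divr_gt0.
exists d => // x; apply: contrapT => np.
have : \sum_i p i x <= \sum_(i : I) (2 * d).
  apply: ler_sum => i _; rewrite leNgt; apply/negP => pi.
  by apply: np; exists i.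
rewrite sumr_const -[X in _ <= X]mulr_natl => h.
have := x1P x (mem_set Logic.I); have : \sum_i p i x1 = d * (3 * #|I|.+1%:R).
  by rewrite /d divfK// gt_eqF.
rewrite -natr1 => ->; have : 0 <= (#|I|%:R : R) by [].
have : 0 <= d * #|I|%:R by rewrite mulr_ge0// ltW.
lra.
Qed.

(* Hemmingsen's criterion, localized to K. The distances to the complements,
   once perturbed so as not to coincide anywhere on K, become functions q t; the
   open sets on which q t is not the minimum then cover K and have no common
   point. *)
Lemma shrink_common (x0 : X) m k (U : 'I_k -> set X) (K : set X)
    (J : {set 'I_k}) :
  closed K -> avoidable m K -> (m < #|J|)%N ->
  (forall i, open (U i)) -> \bigcup_i U i = [set: X] ->
  exists W : 'I_k -> set X,
    [/\ forall i, open (W i), \bigcup_i W i = [set: X],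
        forall i, W i `<=` U i & K `&` \bigcap_(i in [set` J]) W i = set0].
Proof.
move=> clK aK mJ oU UT.
have [z zJ] : exists z, z \in J by apply/card_gt0P; exact: leq_ltn_trans mJ.
(* Together with [z], the members of [s] are [m + 1] elements of [J]. *)
pose s := take m (enum (J :\ z)%SET).
have ss : size s = m.
  by rewrite size_takel// -cardE -ltnS; move: mJ; rewrite (cardsD1 z J) zJ add1n.
have us : uniq s by rewrite take_uniq// enum_uniq.
have sJ j : j \in s -> j \in (J :\ z)%SET by move=> /mem_take; rewrite mem_enum.
pose D j x : R := dist_compl (U j) x.
have cD j : continuous (D j) by exact: dist_compl_continuous.
have D_gt0 j x : 0 < D j x -> U j x.
  move=> Dj; apply: contrapT => nU; move: Dj.
  by rewrite /D dist_compl_eq0// ltxx.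
(* The sets with index outside [s], [U z] among them, are merged into one class [None]. This leaves
   [m + 1] functions [p t], and [T] sends an index to its class. *)
pose pz x : R := \sum_(j <- [seq j <- index_enum 'I_k | j \notin s]) D j x.
have cpz : continuous pz by exact: (@continuous_sum_seq _ _ R).
pose p (t : option 'I_m) x : R := if t is Some i then D (nth z s i) x else pz x.
have cp t : continuous (p t) by case: t => [i|]; [exact: cD|exact: cpz].
have p_ge0 t x : 0 <= p t x.
  by case: t => [i|]; [|apply: sumr_ge0 => j _]; exact: dist_compl_ge0.
pose T j : option 'I_m := insub (index j s).
have TS (i : 'I_m) : T (nth z s i) = Some i.
  rewrite /T index_uniq ?ss// insubT//= => im; congr Some; exact: val_inj.
have TN j : j \notin s -> T j = None.
  by rewrite -index_mem ss => js; rewrite /T insubN.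
have pz_gt0 j x : j \notin s -> U j x -> 0 < pz x.
  move=> js Uj; rewrite /pz big_filter (bigD1 j)//= ltr_pwDl ?dist_compl_gt0//.
  by apply: sumr_ge0 => i _; exact: dist_compl_ge0.
have sum_gt0 x : 0 < \sum_t p t x.
  suff [t pt] : exists t, 0 < p t x.
    by rewrite (bigD1 t)//= ltr_pwDl//; apply: sumr_ge0 => i _.
  have : [set: X] x by []; rewrite -UT => -[j _ Uj].
  have [js|js] := boolP (j \in s); last by exists None; exact: pz_gt0 js Uj.
  have jm : (index j s < m)%N by rewrite -ss index_mem.
  by exists (Some (Ordinal jm)); rewrite /= nth_index// dist_compl_gt0.
have [d d0 dP] := sum_lower_bound x0 cp sum_gt0.
have [|h [ch hg h0]] := aK (fun i x => D (nth z s i) x - pz x) d _ d0.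
  by move=> i x; apply: cvgB; [exact: cD|exact: cpz].
(* The differences [Q (Some i) - Q None] are the [h i], which have no common zero on [K]. *)
pose Q t x : R := if t is Some i then pz x + h i x else pz x.
(* Lowering by [d], the size of the perturbation, ensures that [q t] is positive on [K] only where
   [p t] is. *)
pose q t x : R := Num.max 0 (Q t x - d).
have cQ t : continuous (Q t).
  by case: t => [i|] x; [apply: cvgD; [exact: cpz|exact: ch]|exact: cpz].
have cq t : continuous (q t).
  apply: (@max_fun_continuous _ X R (fun=> 0)); first by move=> x; exact: cvg_cst.
  by move=> x; apply: cvgB; [exact: cQ|exact: cvg_cst].
have Qp t x : K x -> `|Q t x - p t x| <= d.
  move=> Kx; case: t => [i|]; last by rewrite subrr normr0 ltW.
  by rewrite /= addrAC -opprB addrC; exact: hg.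
pose Om t : set X := \bigcup_u [set x | q u x < q t x].
have oOm t : open (Om t) by apply: bigcup_open => u _; exact: open_lt.
have Om0 x : ~ forall t, Om t x.
  move=> Omx; have [u] := Omx [arg min_(t < None) q t x]%O.
  case: arg_minP => // t _ tmin _ /=.
  by rewrite ltNge tmin.
have OmK x : K x -> exists t, Om t x.
  move=> Kx; apply: contrapT => nOm.
  have qE t u : q t x = q u x.
    by apply/eqP; rewrite eq_le !leNgt; apply/andP; split; apply/negP => tu;
      apply: nOm; [exists t, u|exists u, t].
  (* Some [p t] exceeds [2 d], so [q t] is positive. If all [q u] agreed, none would be truncated
     and all [h i] would vanish at [x]. *)
  have [t tP] := dP x; have := Qp t x Kx; rewrite ler_norml => /andP[tQ _].
  have q0 u : 0 < q u x.
    by rewrite -(qE t) /q lt_max subr_gt0; apply/orP; right; lra.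
  have qQ u : q u x = Q u x - d.
    have := q0 u; rewrite /q lt_max ltxx/= => Qu.
    by rewrite max_r// ltW.
  have [i hi] := h0 x Kx; move/negP: hi; apply.
  by have := qE (Some i) None; rewrite !qQ /=; lra.
have Om_p t x : K x -> Om t x -> 0 < p t x.
  move=> Kx [u _ /= ut].
  have : 0 < q t x by apply: le_lt_trans ut; rewrite /q le_max lexx.
  rewrite /q lt_max ltxx/= => Qd.
  have := Qp t x Kx; rewrite ler_norml; lra.
(* Off [K] nothing changes. A point of [K] common to the sets indexed by [J] would lie in every
   [Om t], since [s] and [z] represent all the classes. *)
exists (fun j => (U j `&` Om (T j)) `|` (U j `\` K)); split.
- by move=> j; apply: openU; [exact: openI|apply: openI => //; rewrite openC].
- apply/seteqP; split => // x _.
  have [Kx|Kx] := pselect (K x); last first.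
    by have : [set: X] x by []; rewrite -UT => -[j _ Uj]; exists j => //; right.
  have [t Omt] := OmK x Kx; have := Om_p t x Kx Omt.
  case: t Omt => [i|] Omt /= pt.
    by exists (nth z s i) => //; left; rewrite TS; split => //; exact: D_gt0.
  have [j [js Uj]] : exists j, j \notin s /\ U j x.
    apply: contrapT => nj; move: pt; rewrite /pz big_seq big1 ?ltxx// => j.
    rewrite mem_filter => /andP[js _]; apply: dist_compl_eq0 => Uj.
    by apply: nj; exists j.
  by exists j => //; left; rewrite TN.
- by move=> j x [] [].
rewrite -subset0 => x [Kx Wx]; apply: (Om0 x) => t.
have inJ j : j \in J -> Om (T j) x by move=> jJ; have [[]|[]] := Wx j jJ.
case: t => [i|].
  rewrite -TS; apply: inJ.
  have : nth z s i \in s by rewrite mem_nth// ss.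
  by move=> /sJ; rewrite inE => /andP[].
rewrite -(TN z); first exact: inJ.
by apply/negP => /sJ; rewrite !inE eqxx.
Qed.

(** [shrink_common] is iterated over all pairs of [J] and [i]; intersections already empty on some
    [K i] stay so under further shrinking. *)
Lemma shrink_all (x0 : X) m k (I : eqType) (K : I -> set X) (s : seq I)
    (Js : seq {set 'I_k}) (U : 'I_k -> set X) :
  (forall i, closed (K i)) -> (forall i, avoidable m (K i)) ->
  (forall i, open (U i)) -> \bigcup_i U i = [set: X] ->
  exists W : 'I_k -> set X,
    [/\ forall i, open (W i), \bigcup_i W i = [set: X],
        forall i, W i `<=` U i &
        forall J i, J \in Js -> (m < #|J|)%N -> i \in s ->
          K i `&` \bigcap_(j in [set` J]) W j = set0].
Proof.
move=> clK aK oU UT.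
have one (J : {set 'I_k}) (V : 'I_k -> set X) : (m < #|J|)%N ->
    (forall i, open (V i)) -> \bigcup_i V i = [set: X] ->
    exists W : 'I_k -> set X,
    [/\ forall i, open (W i), \bigcup_i W i = [set: X],
        forall i, W i `<=` V i &
        forall i, i \in s -> K i `&` \bigcap_(j in [set` J]) W j = set0].
  move=> mJ oV VT; elim: s => [|i s [W [oW WT WV Ws]]].
    by exists V; split => // j x.
  have [W' [oW' WT' WW' W's]] := shrink_common x0 (clK i) (aK i) mJ oW WT.
  exists W'; split => // [j|i'].
      exact: subset_trans (WW' j) (WV j).
    rewrite in_cons => /orP[/eqP ->//|i's].
  rewrite -subset0 -(Ws i' i's) => x [Kx Wx]; split => // j Jj.
  exact/WW'/Wx.
elim: Js => [|J Js [W [oW WT WU Ws]]].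
  by exists U; split => // j x.
have [mJ|Jm] := ltnP m #|J|; last first.
  exists W; split => // J' i; rewrite in_cons => /orP[/eqP ->|J's]; last exact: Ws.
  by rewrite ltnNge Jm.
have [W' [oW' WT' WW' W's]] := one J W mJ oW WT.
exists W'; split => // [j|J' i]; first exact: subset_trans (WW' j) (WU j).
rewrite in_cons => /orP[/eqP -> _|J's mJ'] is_; first exact: W's.
rewrite -subset0 -(Ws J' i J's mJ' is_) => x [Kx Wx]; split => // j Jj.
exact/WW'/Wx.
Qed.

(** Finitely many balls of half the radius cover [X]. Their closed versions still lie where zeros
    are avoidable, so a cover can be shrunk until no [m + 2] members meet on any of them. *)
Lemma covering_dim_le_avoidable (x0 : X) m :
  (forall x, exists2 r : R, 0 < r & avoidable m.+1 (ball x r)) ->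
  covering_dim_le X m.
Proof.
move=> loc k U oU UT.
have /choice[r rP] x : exists r : R, 0 < r /\ avoidable m.+1 (ball x r).
  by have [r r0 ar] := loc x; exists r.
pose K x := [set y | mdist x y <= r x / 2].
have r2 x : 0 < r x / 2 by have [r0 _] := rP x; rewrite divr_gt0.
have clK x : closed (K x).
  rewrite -openC; have -> : ~` K x = [set y | r x / 2 < mdist x y].
    by apply/seteqP; split => y /=; rewrite ltNge => /negP.
  by apply: open_lt; [move=> y; exact: cvg_cst|exact: mdist_continuous].
have aK x : avoidable m.+1 (K x).
  apply: avoidableS (rP x).2 => y /= xy; rewrite ballEmdist/=.
  by rewrite (le_lt_trans xy)// ltr_pdivrMr// ltr_pMr ?ltr1n//; have [] := rP x.
have := @compact_cover_unpointed X x0 _ cX X setT (fun y => ball y (r y / 2)).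
case=> [y _|x _|C _ XC]; first exact: open_mball.
  by exists x => //; exact: ballxx.
have [W [oW WT WU Ws]] := shrink_all x0 (finmap.enum_fset C)
  (enum {set 'I_k}) clK aK oU UT.
exists k, W; split => // [j|J mJ]; first by exists j.
rewrite -subset0 => x Wx; have [y yC yx] := XC x I.
have <- : K y `&` \bigcap_(j in [set` J]) W j = set0.
  by apply: Ws; rewrite ?mem_enum//; rewrite mem_enum.
by split => //=; apply/ltW; move: yx; rewrite ballEmdist.
Qed.

End Avoidance.

(** * Nowhere density, and the partition into three classes *)

Lemma nowhere_dense_packing_dim_lt (R : realType) (X : metricType R)
    (cX : compact [set: X]) (x0 : X) (n m : nat) : (m <= n)%N ->
  m%:R%:E <= dimT R X ->
  nowhere_dense [set f : Cn R cX n | packing_dim (range f) < m%:R%:E].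
Proof.
move=> mn mX; apply: contrapT => /eqP/set0P[f0 /nbhs_ballP[r0 /= r00 f0A]].
(* For [m = 0] no function qualifies, packing dimension being nonnegative; for a successor,
   perturbation bounds the covering dimension by its predecessor. *)
case: m => [|m] in mn mX f0A *.
  have [f [fA _]] := f0A f0 (ballxx _ r00) _ filterT.
  by move: fA; apply/negP; rewrite -leNgt; apply: packing_dim_ge0; exists (f x0), x0.
have := covering_dim_le_avoidable cX x0 (avoidable_local mn r00 f0A).
move=> Xm; move: mX; apply/negP; rewrite -ltNge.
apply: (@le_lt_trans _ _ m%:R%:E); first by apply: ereal_inf_lbound; exists m.
by rewrite lte_fin ltr_nat.
Qed.

(** A nonempty set of natural numbers has a least element, so the infimum is attained. *)
Lemma dimT_nat (R : realType) (X : topologicalType) : dimT R X < +oo ->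
  exists2 d, dimT R X = d%:R%:E & covering_dim_le X d.
Proof.
move=> /ereal_inf_lt[_ [d0 Xd0 _] _].
have ex : exists d, `[< covering_dim_le X d >] by exists d0; exact/asboolP.
have [d /asboolP Xd dmin] := ex_minnP ex; exists d => //.
apply/eqP; rewrite eq_le; apply/andP; split.
  by apply: ereal_inf_lbound; exists d.
apply: le_ereal_inf_tmp => _ [e Xe <-]; rewrite lee_fin ler_nat dmin//.
exact/asboolP.
Qed.

Theorem theorem2p3 (R : realType) (X : metricType R)
    (cX : compact [set: X]) (uX : ~ countable [set: X])
    (n : nat) (n_gt0 : (0 < n)%N)
    (Dim : set 'rV[R]_n -> \bar R)
    (DimE : Dim = packing_dim \/ Dim = upper_box_dim) :
  let m : \bar R := mine n%:R%:E (dimT R X) in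
  let A :=
    [set f : Cn R cX n | 0 <= Dim (range f) /\ Dim (range f) < m] in
  let B :=
    [set f : Cn R cX n | m <= Dim (range f) /\ Dim (range f) < n%:R%:E] in
  let C := [set f : Cn R cX n | Dim (range f) = n%:R%:E] in
  [/\ [/\ A `|` B `|` C = [set: Cn R cX n],
          A `&` B = set0, A `&` C = set0 & B `&` C = set0],
      nowhere_dense A,
      (dimT R X < n%:R%:E -> meagre B /\ dense B) /\
      (n%:R%:E <= dimT R X -> B = set0)
    & residual C].
Proof.
move=> m A B C.
have /set0P[x0 _] : [set: X] != set0.
  by apply: contra_notN uX => /eqP ->; exact: countable0.
have range0 (f : Cn R cX n) : range f !=set0 by exists (f x0), x0.
have Dim_ge0 (f : Cn R cX n) : 0 <= Dim (range f).
  by case: DimE => ->; [exact: packing_dim_ge0|exact: upper_box_dim_ge0].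
have packing_le (f : Cn R cX n) : packing_dim (range f) <= Dim (range f).
  by case: DimE => ->//; apply: packing_dim_le_upper_box_dim; exact: Cn_range_bounded.
have le_box (f : Cn R cX n) : Dim (range f) <= upper_box_dim (range f).
  by case: DimE => ->//; apply: packing_dim_le_upper_box_dim; exact: Cn_range_bounded.
have Dim_le (f : Cn R cX n) : Dim (range f) <= n%:R%:E.
  by rewrite (le_trans (le_box f))// upper_box_dim_le_dim//; exact: Cn_range_bounded.
have mn : m <= n%:R%:E by rewrite /m ge_min lexx.
have ndA : nowhere_dense A.
  (* Even if [X] has infinite dimension, [m] is a natural number. *)
  have [k [kn kX mE]] : exists k, [/\ (k <= n)%N, k%:R%:E <= dimT R X & m = k%:R%:E].
    have [nX|Xn] := leP n%:R%:E (dimT R X).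
      by exists n; split => //; rewrite /m min_l.
    have [d dE _] := dimT_nat (lt_le_trans Xn (leey _)).
    exists d; rewrite -dE lexx /m min_r ?(ltW Xn)//; split => //.
    by move: Xn; rewrite dE lte_fin ltr_nat => /ltnW.
  apply: nowhere_denseS (nowhere_dense_packing_dim_lt cX x0 kn kX).
  by move=> f [_]; rewrite mE; exact: le_lt_trans.
have meagre_lt : meagre [set f : Cn R cX n | Dim (range f) < n%:R%:E].
  apply: meagreS (meagre_packing_dim_lt cX uX) => f /=.
  exact: le_lt_trans.
split => //.
- split.
  + apply/seteqP; split => // f _.
    have [fm|mf] := ltP (Dim (range f)) m; first by left; left.
    have := Dim_le f; rewrite le_eqVlt => /orP[/eqP fn|fn]; first by right.
    by left; right.
  + by rewrite -subset0 => f [[_ fm] [mf _]]; move: fm; rewrite ltNge mf.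
  + rewrite -subset0 => f [[_ fm] fn]; move: fm.
    by rewrite fn ltNge mn.
  + by rewrite -subset0 => f [[_ fn] fE]; move: fn; rewrite fE ltxx.
- split => [Xn|nX].
    split; first by apply: meagreS meagre_lt => f [].
    have [d dE Xd] := dimT_nat (lt_le_trans Xn (leey _)).
    move=> O O0 oO.
    (* Outside the closure of [A] an open part of [O] remains, since [A] is nowhere dense. A
       function there with box dimension at most [d] has [Dim] at least [m], not being in [A]. *)
    have [f [[Of Af] fd]] : (O `&` ~` closure A) `&`
        [set f : Cn R cX n | upper_box_dim (range f) <= d%:R%:E] !=set0.
      apply: dense_upper_box_dim_le => //.
        apply: contrapT => OA; have [g Og] := O0.
        suff : (closure A)^° g by rewrite ndA.
        have : nbhs g O by exact: open_nbhs_nbhs.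
        by apply: filterS => h Oh; apply: contrapT => Ah; apply: OA; exists h.
      by apply: openI => //; rewrite openC; exact: closed_closure.
    exists f; split => //; split.
      rewrite leNgt; apply/negP => fm; apply: Af; apply: subset_closure.
      by split.
    by rewrite (le_lt_trans (le_box f))// (le_lt_trans fd)// -dE.
  rewrite -subset0 => f [mf fn]; move: mf; rewrite /m min_l//.
  by rewrite leNgt fn.
apply: meagreS meagre_lt => f /= fn; rewrite lt_neqAle Dim_le andbT.
exact/eqP.
Qed.
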